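(* Let $(X_t)_{t\in\mathbb{Z}}$ be a strictly stationary $\mathbb{R}^d$-valued sequence which is regularly varying with index $\alpha>0$ and satisfies the mixing condition (M) (defined in the context) with sequences $(m_n),(r_n)$. Let $A\subset\overline{\mathbb{R}}^d_0$ be a Borel set bounded away from zero such that $A$ is a continuity set with respect to $\mu_0$ and, for every $h\ge 1$, the sets $A\times\overline{\mathbb{R}}^{dh}$ and $A\times\overline{\mathbb{R}}^{d(h-1)}\times A$ are continuity sets with respect to $\mu_h$. Assume also that $\mu_0(A)>0$ and $\sum_{h\ge1}\rho_A(h)<\infty$. Let $\lambda,\omega$ be either any two Fourier frequencies (which may depend on $n$) or any two fixed frequencies in $(0,\pi)$. Then: (1) If $\lambda,\omega$ are distinct, then the covariances of the pairs $(\alpha_n(\lambda),\beta_n(\omega))$, $(\alpha_n(\lambda),\alpha_n(\omega))$, $(\beta_n(\lambda),\beta_n(\omega))$ converge to zero as $n\to\infty$. (2) The covariance of $(\alpha_n(\lambda),\beta_n(\lambda))$ converges to zero as $n\to\infty$. (3) If $\lambda\in(0,\pi)$ is fixed and $(\lambda_n)$ are Fourier frequencies with $\lambda_n\to\lambda$, then each of $\operatorname{var}(\alpha_n(\lambda_n))$, $\operatorname{var}(\alpha_n(\lambda))$, $\operatorname{var}(\beta_n(\lambda_n))$, $\operatorname{var}(\beta_n(\lambda))$ converges, as $n\to\infty$, to $$\mu_0(A)\Big[1+2\sum_{h=1}^\infty\cos(\lambda h)\rho_A(h)\Big]=\mu_0(A)f_A(\lambda).$$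
   Context: Notation: $\overline{\mathbb{R}}=\mathbb{R}\cup\{\pm\infty\}$, $\overline{\mathbb{R}}^k_0=\overline{\mathbb{R}}^k\setminus\{\mathbf 0\}$. A set is bounded away from zero if its closure does not contain $\mathbf 0$. Regular variation: the strictly stationary sequence $(X_t)$ is regularly varying with index $\alpha>0$ if, with $(a_n)$ chosen such that $a_n\to\infty$ and $nP(|X_0|>a_n)\to1$, for every $h\ge0$ there is a non-null Radon measure $\mu_h$ on the Borel $\sigma$-field of $\overline{\mathbb{R}}^{d(h+1)}_0$ (where bounded sets are those bounded away from zero) such that, with $Y_h=(X_0,\ldots,X_h)$, $nP(a_n^{-1}Y_h\in\cdot)\to\mu_h(\cdot)$ vaguely, and $\mu_h(tC)=t^{-\alpha}\mu_h(C)$ for $t>0$ and Borel $C$ (equivalently $P(x^{-1}Y_h\in\cdot)/P(|X_0|>x)\to\mu_h(\cdot)$ vaguely as $x\to\infty$). Extremogram and spectral density: $\rho_A(h)=\lim_{x\to\infty}P(x^{-1}X_h\in A\mid x^{-1}X_0\in A)$, $h\ge0$ (the limit exists under the stated continuity conditions), $\rho_A(-h)=\rho_A(h)$, and $f_A(\lambda)=\sum_{h\in\mathbb{Z}}\rho_A(h)e^{-ih\lambda}$, $\lambda\in[0,\pi]$. Condition (M): $(X_t)$ is strongly mixing with rate function $(\xi_h)$, $\xi_h=\sup\{|P(C\cap D)-P(C)P(D)|: C\in\sigma(X_s,s\le0), D\in\sigma(X_s,s\ge h)\}\to0$. There exist integer sequences $m=m_n\to\infty$, $r_n\to\infty$ with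 $m_n/n\to0$, $r_n/m_n\to0$, $\lim_{n\to\infty}m_n\sum_{h=r_n}^\infty\xi_h=0$, and for all $\epsilon>0$, $\lim_{k\to\infty}\limsup_{n\to\infty}m_n\sum_{h=k}^{r_n}P(|X_h|>\epsilon a_m,|X_0|>\epsilon a_m)=0$, where $a_m=a_{m_n}$. These $(m_n),(r_n)$ are used throughout. Set $I_t=\mathbf 1\{X_t/a_m\in A\}$, $p_0=P(a_m^{-1}X_0\in A)$, $\widetilde I_t=I_t-p_0$, and $$\alpha_n(\lambda)=\Big(\frac{2m_n}{n}\Big)^{1/2}\sum_{t=1}^n\widetilde I_t\cos(\lambda t),\qquad \beta_n(\lambda)=\Big(\frac{2m_n}{n}\Big)^{1/2}\sum_{t=1}^n\widetilde I_t\sin(\lambda t).$$ A Fourier frequency (for sample size $n$) is a number of the form $2\pi j/n$ with integer $j$.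
   Formalization: In (1), for the pairs (α,α) and (β,β), ''distinct'' is taken to mean λ ≠ ±ω modulo 2π (plain distinctness on [0,π]); for Fourier frequencies with arbitrary integer j, ω = 2π − λ would make the covariance ± a variance. *)

(* Defs.v *)
From HB Require Import structures.
From mathcomp Require Import all_boot all_order all_algebra.
From mathcomp Require Import all_classical all_reals all_analysis.
From mathcomp Require Import complex zify ring lra.

Set Implicit Arguments.
Unset Strict Implicit.
Unset Printing Implicit Defensive.

Import Order.TTheory GRing.Theory Num.Theory.
Import numFieldNormedType.Exports.

Local Open Scope classical_set_scope.
Local Open Scope ring_scope.

Definition borel (T : topologicalType) : set (set T) := <<s @open T >>.

Definition boundary (T : topologicalType) (B : set T) : set T :=
  closure B `\` interior B.

(* k x d matrices with entries in [-oo, +oo], carrying the product topology and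
   its Borel sigma-algebra.  With k = h.+1 this is the compactification of
   R^(d(h+1)) in which (X_0, ..., X_h) lives, X_i being the i-th row. *)
Notation xmx R k d := 'M[\bar R]_(k, d).
Notation bxmx R k d := (g_sigma_algebraType (@open (xmx R k d))).

Section ExtendedSpace.
Context {R : realType} {k d : nat}.
Implicit Types B C : set (xmx R k d).

Definition xorigin : xmx R k d := const_mx 0%E.

Definition bounded_away_from_zero B : Prop := ~ closure B xorigin.

Definition embed_mx (M : 'M[R]_(k, d)) : xmx R k d := map_mx (@EFin R) M.

Definition dilation (t : R) C : set (xmx R k d) :=
  [set map_mx (fun y => t%:E * y)%E M | M in C].

(* A Radon measure on the punctured space is represented by its extension by
   zero to the origin.  Local finiteness is finiteness on the sets bounded away
   from zero, because the compact subsets of the punctured space are its closed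
   subsets that are bounded away from zero. *)
Definition radon_off_zero (mu : {measure set (bxmx R k d) -> \bar R}) : Prop :=
  mu [set xorigin] = 0%E /\
  forall B, borel B -> bounded_away_from_zero B -> (mu B < +oo)%E.

(* The continuous functions with compact support on the punctured space, again
   extended by zero to the origin. *)
Definition vague_test (f : xmx R k d -> R) : Prop :=
  continuous f /\ \forall M \near xorigin, f M = 0.

(* Only used for sets B whose closure avoids the origin, for which the
   boundary is the same in the punctured space and in the whole space. *)
Definition continuity_set (mu : {measure set (bxmx R k d) -> \bar R}) B : Prop :=
  mu (boundary B) = 0%E.

End ExtendedSpace.

Definition enorm {R : realType} {d : nat} (x : 'rV[R]_d) : R :=
  Num.sqrt (\sum_(j < d) x 0 j ^+ 2).

Section Sequence.
Context {disp : measure_display} {Om : measurableType disp} {R : realType}.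
Variable P : probability Om R.
Context {d : nat}.
Variable X : int -> Om -> 'rV[R]_d.

Definition random_vectors : Prop :=
  forall t (B : set 'rV[R]_d), borel B -> measurable (X t @^-1` B).

Definition sample (k : nat) (u : 'I_k -> int) (w : Om) : 'M[R]_(k, d) :=
  \matrix_(i, j) X (u i) w 0 j.

Definition strictly_stationary : Prop :=
  forall (k : nat) (u : 'I_k -> int) (s : int) (B : set 'M[R]_(k, d)),
    borel B ->
    P (sample (fun i => u i + s) @^-1` B) = P (sample u @^-1` B).

Definition Yvec (h : nat) (w : Om) : 'M[R]_(h.+1, d) :=
  sample (fun i : 'I_h.+1 => (i : nat)%:Z) w.

(* Vague convergence of n P(Y_h / a_n \in .) to mu_h is tested on vague_test;
   n E[f (Y_h / a_n)] is the integral of f against that measure. *)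
Record regularly_varying (al : R) (a : nat -> R)
    (mu : forall h : nat, {measure set (bxmx R h.+1 d) -> \bar R}) : Prop := {
  rv_index : 0 < al;
  rv_infty : a n @[n --> \oo] --> +oo;
  rv_norm : (n%:R%:E * P [set w | (a n < enorm (X 0 w))%R])%E @[n --> \oo] --> 1%E;
  rv_radon : forall h, radon_off_zero (mu h);
  rv_nonnull : forall h, mu h setT <> 0%E;
  rv_vague : forall h (f : xmx R h.+1 d -> R), vague_test f ->
    (n%:R%:E * \int[P]_w (f (embed_mx ((a n)^-1 *: Yvec h w)))%:E)%E
      @[n --> \oo] --> (\int[mu h]_M (f M)%:E)%E;
  rv_homogeneous : forall h (t : R) (C : set (xmx R h.+1 d)),
    0 < t -> borel C -> mu h (dilation t C) = ((t `^ (- al))%:E * mu h C)%E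
}.

Definition sigma_of (S : set int) : set (set Om) :=
  <<s [set C | exists2 t, S t &
                exists2 B : set 'rV[R]_d, borel B & C = X t @^-1` B] >>.

Definition mixing_rate (h : nat) : R :=
  sup [set `|fine (P (C `&` D)) - fine (P C) * fine (P D)| |
        C in sigma_of [set t | t <= 0] & D in sigma_of [set t | h%:Z <= t]].

Record condition_M (a : nat -> R) (m r : nat -> nat) : Prop := {
  cM_mixing : mixing_rate h @[h --> \oo] --> 0;
  cM_m : m n @[n --> \oo] --> \oo;
  cM_r : r n @[n --> \oo] --> \oo;
  cM_mn : (m n)%:R / n%:R @[n --> \oo] --> (0 : R);
  cM_rm : (r n)%:R / (m n)%:R @[n --> \oo] --> (0 : R);
  cM_tail :
    ((m n)%:R%:E * \sum_(r n <= h <oo) (mixing_rate h)%:E)%E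
      @[n --> \oo] --> 0%E;
  cM_cluster : forall eps : R, 0 < eps ->
    limn_esup (fun n => (m n)%:R%:E *
      \sum_(k <= h < (r n).+1)
        P [set w | (eps * a (m n) < enorm (X h%:Z w))%R /\
                   (eps * a (m n) < enorm (X 0 w))%R])%E
      @[k --> \oo] --> 0%E
}.

Section Extremogram.
Variable A : set (xmx R 1 d).

Definition exceeds (x : R) (t : int) : set Om :=
  [set w | A (embed_mx (x^-1 *: X t w))].

Definition extremogram (h : int) : R :=
  lim (fine (P (exceeds x `|h|%N%:Z `&` exceeds x 0)) / fine (P (exceeds x 0))
         @[x --> +oo]).

Definition expi (x : R) : R[i] := Complex (cos x) (sin x).

(* The sum over all integers h, as the limit of the sums over |h| <= N. *)
Definition spectral_density (lam : R) : R[i] :=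
  lim ((\sum_(k < (N.*2).+1)
          let h : int := (k : nat)%:Z - N%:Z in
          real_complex R (extremogram h) * expi (- (h%:~R * lam)) : R[i]^o)
         @[N --> \oo]).

Section Periodogram.
Variables (a : nat -> R) (m : nat -> nat).

Definition centered_indicator (n : nat) (t : int) (w : Om) : R :=
  \1_(exceeds (a (m n)) t) w - fine (P (exceeds (a (m n)) 0)).

Definition alpha_n (n : nat) (lam : R) (w : Om) : R :=
  Num.sqrt (2 * (m n)%:R / n%:R) *
  \sum_(1 <= t < n.+1) centered_indicator n t%:Z w * cos (lam * t%:R).

Definition beta_n (n : nat) (lam : R) (w : Om) : R :=
  Num.sqrt (2 * (m n)%:R / n%:R) *
  \sum_(1 <= t < n.+1) centered_indicator n t%:Z w * sin (lam * t%:R).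

End Periodogram.
End Extremogram.
End Sequence.

Section Frequencies.
Context {R : realType}.
Implicit Types x y : R.

Definition fourier_frequency (n : nat) x : Prop :=
  exists j : int, x = 2 * pi * j%:~R / n%:R.

(* For small n there need not be two distinct Fourier frequencies, so a choice
   of Fourier frequencies is only required for all large n. *)
Definition fourier_sequence (lam : nat -> R) : Prop :=
  \forall n \near \oo, fourier_frequency n (lam n).

Definition fixed_frequency (lam : nat -> R) : Prop :=
  exists2 l : R, 0 < l < pi & forall n, lam n = l.

(* x and y give the same values of t |-> cos (x t), and the same values of
   t |-> sin (x t) up to a sign, at the integers t.  For instance 2 pi j / n and
   2 pi (n - j) / n are aliased, and alpha_n is the same at both; in [0, pi]
   aliased frequencies are equal. *)
Definition aliased x y : Prop :=
  exists k : int, x = y + 2 * pi * k%:~R \/ x = - y + 2 * pi * k%:~R.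

Lemma aliased_itv x y : 0 <= x <= pi -> 0 <= y <= pi -> aliased x y <-> x = y.
Proof.
move=> /andP[x0 xp] /andP[y0 yp]; split; last first.
  by move=> ->; exists 0; left; rewrite mulr0 addr0.
have pi0 := pi_gt0 R.
have bound (k : int) (b : int) : 2 * pi * k%:~R < 2 * pi * b%:~R :> R -> k < b.
  by rewrite ltr_pM2l ?mulr_gt0// ltr_int.
have bound0 (k : int) (b : int) : 2 * pi * b%:~R < 2 * pi * k%:~R :> R -> b < k.
  by rewrite ltr_pM2l ?mulr_gt0// ltr_int.
case=> k [xy|xy].
  have k1 : k < 1 by apply: bound; rewrite mulr1; lra.
  have k0 : -1 < k by apply: bound0; rewrite mulrN1z mulrN; lra.
  have k_0 : k = 0 by lia.
  by rewrite xy k_0 mulr0 addr0.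
have k2 : k < 2 by apply: bound; rewrite mulrz_nat; lra.
have k0 : -1 < k by apply: bound0; rewrite mulrN1z; lra.
have [k_0|k_1] : k = 0 \/ k = 1 by lia.
  by move: xy; rewrite k_0 mulr0; lra.
by move: xy; rewrite k_1 mulr1; lra.
Qed.

End Frequencies.

(* Main.v *)
Require Import Defs.
From HB Require Import structures.
From mathcomp Require Import all_boot all_order all_algebra.
From mathcomp Require Import all_classical all_reals all_analysis.
From mathcomp Require Import complex zify ring lra.

(** The covariance of two weighted sums of the centred exceedance indicators is a
    quadratic form whose Toeplitz matrix has the entries
    [m_n cov (I_0, I_h)], [lag_covariance] below, up to the factor [2 / n]. The
    proof finds the limit of each entry, shows that the large lags do not matter,
    and is then left with trigonometric averages at a fixed lag.

    At a fixed lag, the probability of a joint exceedance at times 0 and [h] times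
    [m_n] tends to the measure of [A x R^(d(h-1)) x A] under [mu_h]
    ([portmanteau], [lag_covariance_cvg]), while the product of the means is
    smaller by the factor [1 / m_n]. Between a large lag [k] and [r_n] joint
    exceedances are rare by the anti-clustering condition, and beyond [r_n] the
    covariances are bounded by the mixing rate ([lag_covariance_tail]). The tail
    sums being uniformly small, the limit can be taken lag by lag
    ([tannery], [toeplitz_cvg]).

    What remains at lag [h] is the average over [t] of
    [u(t) v(t + h) + u(t + h) v(t)] for trigonometric weights [u] and [v]. The
    product-to-sum formulas turn it into averages of [cos (theta t + phi)] with
    [theta] the sum or the difference of the two frequencies. After multiplication
    by [2 sin (theta / 2)] such a sum telescopes ([sum_cos]): it is zero for a
    Fourier frequency and bounded for a fixed one, unless [theta] is a multiple of
    2 pi. For frequencies that are not aliased this does not happen; for a cosine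
    against a sine the surviving terms cancel in any case; and for the cosines, or
    the sines, of one frequency the difference is zero and leaves
    [cos (lambda h)]. Summed over the lags this gives the cosine series of the
    limiting variance.

    To recognize this series as the spectral density, the limits at a fixed lag
    have to be identified with the extremogram, a limit over all real levels,
    whereas regular variation is known along the sequence [a_n]. The limit of
    [n P (|X_0| > t a_n)] is [t ^ -alpha], by homogeneity of the limit measure and
    the normalization of [a_n]; a continuous and strictly monotone limit forces
    any level [x] to be asymptotic to [a_N] with [N] the integer part of
    [1 / P (|X_0| > x)] ([normalization_index]), and the portmanteau argument
    tolerates such a change of level ([extremogramE]). *)

Set Implicit Arguments.
Unset Strict Implicit.
Unset Printing Implicit Defensive.

Import Order.TTheory GRing.Theory Num.Theory.
Import numFieldNormedType.Exports.

Local Open Scope classical_set_scope.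
Local Open Scope ring_scope.

(** * Averages of trigonometric sequences *)

Section TrigonometricAverages.
Context {R : realType}.
Implicit Types (x y th ph : R) (lam om : nat -> R).

Definition average (n : nat) (f : nat -> R) : R :=
  n%:R^-1 * \sum_(1 <= t < n.+1) f t.

Lemma averageD n f g :
  average n (fun t => f t + g t) = average n f + average n g.
Proof. by rewrite /average big_split mulrDr. Qed.

Lemma averageB n f g :
  average n (fun t => f t - g t) = average n f - average n g.
Proof. by rewrite /average sumrB mulrBr. Qed.

Lemma averageZ n c f : average n (fun t => c * f t) = c * average n f.
Proof. by rewrite /average -mulr_sumr mulrCA. Qed.

Lemma sin_mul2_cos x y : 2 * sin x * cos y = sin (y + x) - sin (y - x).
Proof. by rewrite sinD sinB; ring. Qed.

(** Multiplying by twice the sine of half the frequency makes the sum telescope.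
    All the cancellations below come from this identity. *)
Lemma sum_cos th ph n :
  2 * sin (th / 2) * (\sum_(1 <= t < n.+1) cos (th * t%:R + ph)) =
  sin (th * n%:R + ph + th / 2) - sin (ph + th / 2).
Proof.
elim: n => [|n IHn]; first by rewrite big_geq// !mulr0 add0r subrr.
rewrite big_nat_recr//= mulrDr IHn sin_mul2_cos.
have -> : th * n.+1%:R + ph - th / 2 = th * n%:R + ph + th / 2.
  by rewrite -natr1; field.
by ring.
Qed.

Lemma sin_half0_cos th ph (t : nat) :
  sin (th / 2) = 0 -> cos (th * t%:R + ph) = cos ph.
Proof.
move=> s0; have thE : th = (th / 2) *+ 2 by rewrite mulr2n -splitr.
have sth : sin th = 0 by rewrite thE sin_mulr2n s0 mulr0 mul0rn.
have cth : cos th = 1.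
  rewrite thE cos_mulr2n; have /eqP := cos2Dsin2 (th / 2).
  by rewrite s0 expr0n addr0 => /eqP ->; rewrite mulr2n addrK.
elim: t => [|t IHt]; first by rewrite mulr0 add0r.
rewrite -natr1 mulrDr mulr1 addrAC cosD sth cth mulr1 mulr0 subr0.
exact: IHt.
Qed.

Lemma sin_half0_sin th ph (t : nat) :
  sin (th / 2) = 0 -> sin (th * t%:R + ph) = sin ph.
Proof. by move=> s0; rewrite -!cosBpihalf -addrA sin_half0_cos. Qed.

Lemma sin_eq0_mulpi x : sin x = 0 -> exists k : int, x = pi * k%:~R.
Proof.
move=> sx0; have pi0 := pi_gt0 R.
pose k := Num.floor (x / pi); exists k.
have /andP[kx xk] := mem_rg1_floor (x / pi).
have skpi (j : int) (z : R) : sin (z + pi * j%:~R) = (-1) ^ j * sin z.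
  have S (p : nat) (w : R) : sin (w + pi * p%:R) = (-1) ^+ p * sin w.
    elim: p w => [|p IHp] w; first by rewrite mulr0 addr0 mul1r.
    by rewrite -natr1 mulrDr mulr1 addrA sinDpi IHp exprS mulN1r mulNr.
  case: j => p; first exact: S.
  have := S p.+1 (z + pi * (Negz p)%:~R).
  rewrite NegzE mulrNz mulrN -pmulrn subrK => ->.
  by rewrite mulrA -exprnN mulVr ?mul1r// unitrX// unitrN1.
have x0 : 0 <= x - pi * k%:~R.
  by rewrite subr_ge0 -ler_pdivlMl// mulrC ge_floor.
have xpi : x - pi * k%:~R < pi.
  rewrite ltrBlDr -[X in X + _]mulr1 -mulrDr -ltr_pdivrMl// mulrC addrC.
  by rewrite -intrD1 floorD1_gt.
have s0 : sin (x - pi * k%:~R) = 0.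
  by rewrite -mulrN -mulrNz skpi sx0 mulr0.
apply/eqP; rewrite -subr_eq0 eq_le x0 andbT leNgt; apply/negP => xp.
have : 0 < sin (x - pi * k%:~R) by apply: sin_gt0_pi; rewrite xp xpi.
by rewrite s0 ltxx.
Qed.

(** The multiples of 2 pi are the only frequencies at which averages of cosines
    do not cancel. *)
Definition resonance th : R := (sin (th / 2) == 0)%:R.

(** The phases are allowed to vary with [n] because those produced by the
    product-to-sum formulas depend on the frequencies. *)
Definition equidistributed lam := forall ph : nat -> R,
  average n (fun t => cos (lam n * t%:R + ph n)) - resonance (lam n) * cos (ph n)
    @[n --> \oo] --> 0.

Lemma average_cst_nat c n : (0 < n)%N -> average n (fun=> c) = c.
Proof.
move=> n0; rewrite /average sumr_const_nat subn1/= -[c *+ n]mulr_natl mulKf//.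
by rewrite pnatr_eq0 -lt0n.
Qed.

Lemma average_resonant th ph n : (0 < n)%N -> sin (th / 2) = 0 ->
  average n (fun t => cos (th * t%:R + ph)) = cos ph.
Proof.
move=> n0 s0; rewrite -[RHS](average_cst_nat _ n0) /average.
by under eq_bigr do rewrite sin_half0_cos//.
Qed.

(** The [n] times cover whole periods of the cosine: the two ends of the telescoped
    sum coincide, and off resonance the average vanishes exactly, however close
    the frequency is to a resonance. *)
Lemma equidistributed_fourier lam : fourier_sequence lam -> equidistributed lam.
Proof.
move=> Flam ph; apply: cvg_near_cst.
near=> n; have n0 : (0 < n)%N by near: n; exact: nbhs_infty_gt.
have [j jE] : fourier_frequency n (lam n) by near: n.
rewrite /resonance; have [/eqP s0|s0] := boolP (_ == 0).
  by rewrite average_resonant// mul1r subrr.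
have := sum_cos (lam n) (ph n) n.
rewrite mul0r subr0 {3}jE divfK ?pnatr_eq0 -?lt0n//.
have -> : sin (2 * pi * j%:~R + ph n + lam n / 2) = sin (ph n + lam n / 2).
  have S (p : nat) (w : R) : sin (2 * pi * p%:R + w) = sin w.
    elim: p => [|p IHp]; first by rewrite mulr0 add0r.
    rewrite -[RHS]IHp -[RHS]sinD2pi; congr sin.
    by rewrite -[p.+1]addn1 natrD -[pi *+ 2]mulr_natl; ring.
  case: j {jE} => p; first by rewrite -addrA S.
  rewrite NegzE mulrNz mulrN -pmulrn.
  by rewrite -[LHS](S p.+1); congr sin; ring.
rewrite subrr => /eqP; rewrite !mulf_eq0 pnatr_eq0/= (negbTE s0)/=.
by rewrite /average => /eqP ->; rewrite mulr0.
Unshelve. all: by end_near. Qed.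

(** Off resonance the telescoped sum stays bounded. *)
Lemma equidistributed_cst th : equidistributed (fun=> th).
Proof.
move=> ph; rewrite /resonance; have [/eqP s0|s0] := boolP (_ == 0).
  apply: cvg_near_cst; near=> n.
  have n0 : (0 < n)%N by near: n; exact: nbhs_infty_gt.
  by rewrite average_resonant// mul1r subrr.
set sn := sin (th / 2) in s0 *.
have b n : `|sn| * `|\sum_(1 <= t < n.+1) cos (th * t%:R + ph n)| <= 1.
  rewrite -normrM -(ler_pM2l (@ltr0Sn R 1)) mulr1.
  rewrite -[X in X * _](ger0_norm (ler0n R 2)) -normrM mulrA sum_cos.
  by apply: (le_trans (ler_normB _ _)); rewrite -[2]/(1 + 1) lerD// sin_max.
apply/cvgr0Pnorm_le => e e0.
have e1 : 0 < e * `|sin (th / 2)| by rewrite mulr_gt0// normr_gt0.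
near=> n; have n0 : (0 < n)%N by near: n; exact: nbhs_infty_gt.
rewrite mul0r subr0 /average normrM ger0_norm ?invr_ge0//.
rewrite ler_pdivrMl ?ltr0n// -(ler_pM2l (_ : 0 < `|sn|)) ?normr_gt0//.
apply: (le_trans (b n)); rewrite mulrCA [`|sn| * _]mulrC -ler_pdivrMr// mul1r.
by near: n; exact: nbhs_infty_ger.
Unshelve. all: by end_near. Qed.

Lemma average_sin lam (ph : nat -> R) : equidistributed lam ->
  average n (fun t => sin (lam n * t%:R + ph n)) - resonance (lam n) * sin (ph n)
    @[n --> \oo] --> 0.
Proof.
move=> /(_ (fun n => ph n - pi / 2)).
under eq_fun do rewrite cosBpihalf.
under eq_fun do (under [X in average _ X]eq_fun do rewrite addrA cosBpihalf).
exact.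
Qed.

(** The common shape of the product-to-sum expansions below, where [s] is the sign
    between the two frequencies. *)
Lemma cvg0_half_sum4 (s : R) (f1 f2 f3 f4 g : nat -> R) :
  f1 n @[n --> \oo] --> 0 -> f2 n @[n --> \oo] --> 0 ->
  f3 n @[n --> \oo] --> 0 -> f4 n @[n --> \oo] --> 0 ->
  (forall n, g n = 2^-1 * ((f1 n + f2 n) + s * (f3 n + f4 n))) ->
  g n @[n --> \oo] --> 0.
Proof.
move=> c1 c2 c3 c4 gE.
have -> : g = fun n => 2^-1 * ((f1 n + f2 n) + s * (f3 n + f4 n)) by apply/funext.
rewrite [X in _ --> X](_ : _ = 2^-1 * ((0 + 0) + s * (0 + 0))); last by ring.
by apply: cvgMl_tmp; apply: cvgD; [exact: cvgD | apply: cvgMl_tmp; exact: cvgD].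
Qed.

(** Lags [h] and [-h] are taken together, as they have the same weight in a
    symmetric Toeplitz form. *)
Definition cross_average (u v : nat -> R) (n h : nat) : R :=
  average n (fun t => u t * v (t + h)%N + u (t + h)%N * v t).

Lemma cross_average_cos_cos lam om (h : nat) :
  equidistributed (lam \+ om) -> equidistributed (lam \- om) ->
  cross_average (fun t => cos (lam n * t%:R)) (fun t => cos (om n * t%:R)) n h -
  (resonance (lam n - om n) + resonance (lam n + om n)) / 2 *
    (cos (lam n * h%:R) + cos (om n * h%:R)) @[n --> \oo] --> 0.
Proof.
move=> p m.
have a1 := p (fun n => om n * h%:R).
have a2 := p (fun n => lam n * h%:R).
have a3 := m (fun n => - (om n * h%:R)).
have a4 := m (fun n => lam n * h%:R).
apply: (cvg0_half_sum4 (s := 1) a1 a2 a3 a4) => n.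
rewrite /= /cross_average cosN.
have -> : (fun t : nat => cos (lam n * t%:R) * cos (om n * (t + h)%:R) +
                    cos (lam n * (t + h)%:R) * cos (om n * t%:R)) =
  (fun t => 2^-1 * ((cos ((lam n + om n) * t%:R + om n * h%:R) +
                     cos ((lam n + om n) * t%:R + lam n * h%:R)) +
                    (cos ((lam n - om n) * t%:R - om n * h%:R) +
                     cos ((lam n - om n) * t%:R + lam n * h%:R)))).
  apply/funext => t; rewrite natrD !mulrDr !mulrDl mulNr.
  set x := lam n * t%:R; set y := om n * t%:R.
  set z := lam n * h%:R; set w := om n * h%:R.
  have -> : x - y - w = x - (y + w) by ring.
  have -> : x - y + z = (x + z) - y by ring.
  have -> : x + y + w = x + (y + w) by ring.
  have -> : x + y + z = (x + z) + y by ring.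
  by rewrite (cosB x) (cosD x (y + w)) (cosB (x + z)) (cosD (x + z) y); field.
by rewrite averageZ !averageD; field.
Qed.

Lemma cross_average_sin_sin lam om (h : nat) :
  equidistributed (lam \+ om) -> equidistributed (lam \- om) ->
  cross_average (fun t => sin (lam n * t%:R)) (fun t => sin (om n * t%:R)) n h -
  (resonance (lam n - om n) - resonance (lam n + om n)) / 2 *
    (cos (lam n * h%:R) + cos (om n * h%:R)) @[n --> \oo] --> 0.
Proof.
move=> p m.
have a1 := p (fun n => om n * h%:R).
have a2 := p (fun n => lam n * h%:R).
have a3 := m (fun n => - (om n * h%:R)).
have a4 := m (fun n => lam n * h%:R).
apply: (cvg0_half_sum4 (s := -1) a3 a4 a1 a2) => n.
rewrite /= /cross_average cosN.
have -> : (fun t : nat => sin (lam n * t%:R) * sin (om n * (t + h)%:R) +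
                    sin (lam n * (t + h)%:R) * sin (om n * t%:R)) =
  (fun t => 2^-1 * ((cos ((lam n - om n) * t%:R - om n * h%:R) +
                     cos ((lam n - om n) * t%:R + lam n * h%:R)) -
                    (cos ((lam n + om n) * t%:R + om n * h%:R) +
                     cos ((lam n + om n) * t%:R + lam n * h%:R)))).
  apply/funext => t; rewrite natrD !mulrDr !mulrDl mulNr.
  set x := lam n * t%:R; set y := om n * t%:R.
  set z := lam n * h%:R; set w := om n * h%:R.
  have -> : x - y - w = x - (y + w) by ring.
  have -> : x - y + z = (x + z) - y by ring.
  have -> : x + y + w = x + (y + w) by ring.
  have -> : x + y + z = (x + z) + y by ring.
  by rewrite (cosB x) (cosD x (y + w)) (cosB (x + z)) (cosD (x + z) y); field.
by rewrite averageZ averageB !averageD; field.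
Qed.

(** Here resonances are harmless: when the sum or the difference of the
    frequencies resonates, the sines of the two frequencies at an integer agree up
    to sign, and the two surviving phases cancel. *)
Lemma cross_average_cos_sin lam om (h : nat) :
  equidistributed (lam \+ om) -> equidistributed (lam \- om) ->
  cross_average (fun t => cos (lam n * t%:R)) (fun t => sin (om n * t%:R)) n h
    @[n --> \oo] --> 0.
Proof.
move=> p m.
have a1 := average_sin (fun n => om n * h%:R) p.
have a2 := average_sin (fun n => lam n * h%:R) p.
have a3 := average_sin (fun n => - (om n * h%:R)) m.
have a4 := average_sin (fun n => lam n * h%:R) m.
apply: (cvg0_half_sum4 (s := -1) a1 a2 a3 a4) => n.
rewrite /= /cross_average sinN.
have rp : resonance (lam n + om n) * (sin (om n * h%:R) + sin (lam n * h%:R)) = 0.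
  rewrite /resonance; case: eqP => [s0|_]; last by rewrite mul0r.
  have -> : lam n * h%:R = (lam n + om n) * h%:R - om n * h%:R by ring.
  by rewrite sin_half0_sin// sinN subrr mulr0.
have rm : resonance (lam n - om n) * (sin (lam n * h%:R) - sin (om n * h%:R)) = 0.
  rewrite /resonance; case: eqP => [s0|_]; last by rewrite mul0r.
  have -> : lam n * h%:R = (lam n - om n) * h%:R + om n * h%:R by ring.
  by rewrite sin_half0_sin// subrr mulr0.
have -> : (fun t : nat => cos (lam n * t%:R) * sin (om n * (t + h)%:R) +
                    cos (lam n * (t + h)%:R) * sin (om n * t%:R)) =
  (fun t => 2^-1 * ((sin ((lam n + om n) * t%:R + om n * h%:R) +
                     sin ((lam n + om n) * t%:R + lam n * h%:R)) -
                    (sin ((lam n - om n) * t%:R - om n * h%:R) +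
                     sin ((lam n - om n) * t%:R + lam n * h%:R)))).
  apply/funext => t; rewrite natrD !mulrDr !mulrDl mulNr.
  set x := lam n * t%:R; set y := om n * t%:R.
  set z := lam n * h%:R; set w := om n * h%:R.
  have -> : x - y - w = x - (y + w) by ring.
  have -> : x - y + z = (x + z) - y by ring.
  have -> : x + y + w = x + (y + w) by ring.
  have -> : x + y + z = (x + z) + y by ring.
  by rewrite (sinB x) (sinD x (y + w)) (sinB (x + z)) (sinD (x + z) y); field.
rewrite averageZ averageB !averageD.
set X1 := average _ _; set X2 := average _ _.
set X3 := average _ _; set X4 := average _ _.
transitivity (2^-1 * (X1 + X2 - (X3 + X4)) -
  2^-1 * (resonance (lam n + om n) * (sin (om n * h%:R) + sin (lam n * h%:R)) -
  resonance (lam n - om n) * (sin (lam n * h%:R) - sin (om n * h%:R)))).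
  by rewrite rp rm subrr mulr0 subr0.
by ring.
Qed.
End TrigonometricAverages.

(** * Limits of Toeplitz quadratic forms *)

Section ToeplitzLimit.
Context {R : realType}.


(** Dominated convergence for sums, with the domination replaced by a uniform
    smallness of the tails, which is what mixing provides. *)
Lemma tannery (x : nat -> nat -> R) (l : nat -> R) :
  (forall h, x n h @[n --> \oo] --> l h) ->
  (forall e : R, 0 < e -> exists k,
     \forall n \near \oo, \sum_(k <= h < n) `|x n h| <= e) ->
  cvgn (fun N => \sum_(0 <= h < N) l h) /\
  \sum_(0 <= h < n) x n h @[n --> \oo] -->
    limn (fun N => \sum_(0 <= h < N) l h).
Proof.
move=> xl tail.
have cvg_part i j : \sum_(i <= h < j) x n h @[n --> \oo] --> \sum_(i <= h < j) l h.
  by apply: cvg_big => [|h _]; [exact: add_continuous|exact: xl].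
have tail_l (e : R) : 0 < e -> exists k, (\forall n \near \oo,
     \sum_(k <= h < n) `|x n h| <= e) /\
     forall N, `|\sum_(k <= h < N) l h| <= e.
  move=> e0; have [k Hk] := tail e e0; exists k; split => // N.
  have cN := cvg_part k N.
  apply: ler_cvg_to (cvg_norm cN) (cvg_cst e) _.
  near=> n; apply: (le_trans (ler_norm_sum _ _ _)).
  apply: (@le_trans _ _ (\sum_(k <= h < n) `|x n h|)); last by near: n.
  have [kN|Nk] := leqP k N; last by rewrite big_geq 1?ltnW// sumr_ge0.
  rewrite [leRHS](@big_cat_nat _ _ _ N)//=; last by near: n; exact: nbhs_infty_ge.
  by rewrite lerDl sumr_ge0.
have split_sum (f : nat -> R) k N : (k <= N)%N ->
  \sum_(0 <= h < N) f h = \sum_(0 <= h < k) f h + \sum_(k <= h < N) f h.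
  by move=> kN; rewrite (@big_cat_nat _ _ _ k).
have cl : cvgn (fun N => \sum_(0 <= h < N) l h).
  apply/cauchy_cvgP/cauchy_exP => e e0.
  have [k [_ kl]] := tail_l (e / 2) ltac:(lra).
  exists (\sum_(0 <= h < k) l h).
  suff : \forall N \near \oo, ball (\sum_(0 <= h < k) l h) e (\sum_(0 <= h < N) l h).
    by [].
  near=> N.
  rewrite /ball/= (split_sum _ k N); last by near: N; exact: nbhs_infty_ge.
  by rewrite opprD addrA subrr sub0r normrN (le_lt_trans (kl N))//; lra.
split => //; apply/cvgrPdist_le => e e0.
have [k [kx kl]] := tail_l (e / 4) ltac:(lra).
have /cvgrPdist_le/(_ (e / 4) ltac:(lra)) cp := cvg_part 0%N k.
have /cvgrPdist_le/(_ (e / 4) ltac:(lra)) [M _ cM] := cl.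
near=> n.
have kn : (k <= n)%N by near: n; exact: nbhs_infty_ge.
have A1 : `|\sum_(0 <= h < k) l h - \sum_(0 <= h < k) x n h| <= e / 4 by near: n.
have A2 : `|\sum_(k <= h < n) x n h| <= e / 4.
  by apply: (le_trans (ler_norm_sum _ _ _)); near: n.
have Mn : (M <= n)%N by near: n; exact: nbhs_infty_ge.
have A3 := cM n Mn.
have A4 := kl n.
rewrite (split_sum (x n) k n)//.
move: A3; rewrite /= (split_sum l k n)// => A3.
move: A1 A2 A3 A4; rewrite !ler_norml.
by move=> /andP[? ?] /andP[? ?] /andP[? ?] /andP[? ?]; apply/andP; split; lra.
Unshelve. all: by end_near. Qed.

(** Every lag but zero occurs on both sides of the diagonal. *)
Definition lag_weight (h : nat) : R := if h == 0%N then 1 else 2.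

(** Grouping the entries by diagonals; the induction adds one row and one column
    at a time. The inner sum takes both signs of the lag and so counts the main
    diagonal twice, whence the weight one half at lag zero. *)
Lemma toeplitz_sum (G : nat -> nat -> R) (g u v : nat -> R) n :
  (forall s t, (s <= t)%N -> G s t = g (t - s)%N) ->
  (forall s t, G s t = G t s) ->
  \sum_(1 <= s < n.+1) \sum_(1 <= t < n.+1) G s t * (u s * v t) =
  \sum_(0 <= h < n) lag_weight h / 2 * g h *
     \sum_(1 <= t < (n - h).+1) (u t * v (t + h)%N + u (t + h)%N * v t).
Proof.
move=> Gg Gsym; elim: n => [|n IHn]; first by rewrite !big_geq.
rewrite big_nat_recr//= [X in _ + X]big_nat_recr//=.
under eq_bigr do rewrite big_nat_recr//=.
rewrite big_split/= IHn.
have -> : \sum_(0 <= h < n.+1) lag_weight h / 2 * g h *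
     \sum_(1 <= t < (n.+1 - h).+1) (u t * v (t + h)%N + u (t + h)%N * v t) =
  \sum_(0 <= h < n.+1) lag_weight h / 2 * g h *
     \sum_(1 <= t < (n - h).+1) (u t * v (t + h)%N + u (t + h)%N * v t) +
  \sum_(0 <= h < n.+1) lag_weight h / 2 * g h *
     (u (n.+1 - h)%N * v n.+1 + u n.+1 * v (n.+1 - h)%N).
  rewrite -big_split/=; apply: eq_big_nat => h /andP[_ hn].
  rewrite ltnS in hn; rewrite -mulrDr subSn// [X in _ * X = _]big_nat_recr//=.
  by rewrite addSn subnK.
rewrite [X in _ = X + _]big_nat_recr//= subnn (@big_geq _ _ _ 1 1)// mulr0 addr0.
rewrite -addrA; congr (_ + _).
rewrite [RHS]big_ltn// {1}/lag_weight/= subn0.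
have -> : \sum_(1 <= i < n.+1) lag_weight i / 2 * g i *
    (u (n.+1 - i)%N * v n.+1 + u n.+1 * v (n.+1 - i)%N) =
  \sum_(1 <= i < n.+1) (G i n.+1 * (u i * v n.+1) + G n.+1 i * (u n.+1 * v i)).
  rewrite big_nat_rev/=; apply: eq_big_nat => h /andP[h0 hn].
  rewrite addSn add0n subSS subKn; last exact: ltnW.
  rewrite Gsym -mulrDr Gsym Gg 1?ltnW// /lag_weight subn_eq0 leqNgt hn/=.
  by rewrite divff// mul1r.
by rewrite big_split/= Gg// subnn; field.
Qed.

Lemma average_shift_le (f : nat -> R) (B : R) n h : (forall t, `|f t| <= B) ->
  `|n%:R^-1 * (\sum_(1 <= t < (n - h).+1) f t) - average n f|
    <= n%:R^-1 * (h%:R * B).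
Proof.
move=> fB; rewrite /average -mulrBr normrM ger0_norm ?invr_ge0//.
rewrite ler_wpM2l ?invr_ge0//.
rewrite [X in _ - X](@big_cat_nat _ _ _ (n - h).+1)//=; last by rewrite ltnS leq_subr.
rewrite opprD addrA subrr sub0r normrN.
apply: (le_trans (ler_norm_sum _ _ _)).
apply: (@le_trans _ _ (\sum_((n - h).+1 <= t < n.+1) B)).
  by apply: ler_sum => t _.
rewrite sumr_const_nat -[B *+ _]mulr_natl; apply: ler_wpM2r; first exact: le_trans (fB 0%N).
by rewrite ler_nat; lia.
Qed.

Lemma average_le (f : nat -> R) (B : R) n k : (forall t, `|f t| <= B) ->
  (k <= n)%N -> `|n%:R^-1 * \sum_(1 <= t < k.+1) f t| <= B.
Proof.
move=> fB kn; have B0 : 0 <= B by rewrite (le_trans _ (fB 0%N)).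
have [->|n0] := posnP n; first by rewrite invr0 mul0r normr0.
rewrite normrM ger0_norm ?invr_ge0// ler_pdivrMl ?ltr0n//.
apply: (le_trans (ler_norm_sum _ _ _)).
apply: (@le_trans _ _ (\sum_(1 <= t < k.+1) B)).
  by apply: ler_sum => t _.
by rewrite sumr_const_nat subn1/= -[B *+ _]mulr_natl ler_wpM2r// ler_nat.
Qed.

(** The quadratic form converges lag by lag: at a fixed lag only boundedly many
    terms are lost at the ends, and the large lags are negligible. *)
Lemma toeplitz_cvg (c u v : nat -> nat -> R) (G : nat -> nat -> nat -> R)
    (C L : nat -> R) :
  (forall n s t, (s <= t)%N -> G n s t = c n (t - s)%N) ->
  (forall n s t, G n s t = G n t s) ->
  (forall h, c n h @[n --> \oo] --> C h) ->
  (forall e : R, 0 < e -> exists k,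
     \forall n \near \oo, \sum_(k <= h < n) `|c n h| <= e) ->
  (forall n t, `|u n t| <= 1) -> (forall n t, `|v n t| <= 1) ->
  (forall h, cross_average (u n) (v n) n h @[n --> \oo] --> L h) ->
  let l h := lag_weight h * C h * L h in
  cvgn (fun N => \sum_(0 <= h < N) l h) /\
  2 / n%:R * \sum_(1 <= s < n.+1) \sum_(1 <= t < n.+1) G n s t * (u n s * v n t)
    @[n --> \oo] --> limn (fun N => \sum_(0 <= h < N) l h).
Proof.
move=> Gc Gsym cC ctail u1 v1 uvL l.
pose f n h t := u n t * v n (t + h)%N + u n (t + h)%N * v n t.
pose T n h := n%:R^-1 * \sum_(1 <= t < (n - h).+1) f n h t.
have f2 n h t : `|f n h t| <= 2.
  apply: (le_trans (ler_normD _ _)); rewrite -[2]/(1 + 1) !normrM.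
  by rewrite lerD// mulr_ile1.
have T2 n h : `|T n h| <= 2 by apply: average_le; rewrite ?leq_subr.
pose x n h := lag_weight h * c n h * T n h.
have w2 h : `|lag_weight h| <= 2.
  by rewrite /lag_weight; case: ifP => _; rewrite ger0_norm// ler1n.
have TL h : T n h @[n --> \oo] --> L h.
  have d0 : T n h - cross_average (u n) (v n) n h @[n --> \oo] --> 0.
    apply/cvgr0Pnorm_le => e e0; near=> n.
    apply: (le_trans (average_shift_le n h (f2 n h))).
    have n0 : (0 < n)%N by near: n; exact: nbhs_infty_gt.
    rewrite ler_pdivrMl ?ltr0n// -ler_pdivrMr//.
    by near: n; exact: nbhs_infty_ger.
  have -> : (fun n => T n h) = (fun n => (T n h - cross_average (u n) (v n) n h)
      + cross_average (u n) (v n) n h) by apply/funext => n; rewrite subrK.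
  by rewrite -[L h]add0r; apply: cvgD.
have xl h : x n h @[n --> \oo] --> l h.
  by apply: cvgM => //; apply: cvgMl_tmp.
have xtail (e : R) : 0 < e -> exists k,
    \forall n \near \oo, \sum_(k <= h < n) `|x n h| <= e.
  move=> e0; have [k Hk] := ctail (e / 4) ltac:(lra); exists k.
  near=> n.
  have H : \sum_(k <= h < n) `|c n h| <= e / 4 by near: n.
  apply: (@le_trans _ _ (\sum_(k <= h < n) 4 * `|c n h|)); last first.
    by rewrite -mulr_sumr; lra.
  apply: ler_sum => h _; rewrite /x normrM normrM mulrAC; apply: ler_wpM2r => //.
  have -> : 4 = 2 * 2 :> R by ring.
  by apply: ler_pM (w2 h) (T2 n h).
have [cl xcl] := tannery xl xtail.
split => //; rewrite (_ : (fun n => _) = fun n => \sum_(0 <= h < n) x n h)//.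
apply/funext => n; rewrite (toeplitz_sum _ _ _ (Gc n) (Gsym n)) mulr_sumr.
apply: eq_bigr => h _; rewrite /x /T /f.
by move: (n%:R^-1 : R) => y; field.
Unshelve. all: by end_near. Qed.

End ToeplitzLimit.

(** * Borel sets of matrices and thickenings *)

Lemma borel_preimage (S T : topologicalType) (f : S -> T) (B : set T) :
  continuous f -> borel B -> borel (f @^-1` B).
Proof.
move=> cf; rewrite /borel.
have S1 : sigma_algebra [set: T] [set C | <<s @open S >> (f @^-1` C)].
  split=> /=; first by rewrite preimage_set0; exact: sigma_algebra0.
  - by move=> C sC; rewrite setTD preimage_setC -setTD; exact: sigma_algebraCD.
  - by move=> F sF; rewrite preimage_bigcup; exact: sigma_algebra_bigcup.
have sub : @open T `<=` [set C | <<s @open S >> (f @^-1` C)].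
  move=> O oO; apply: sub_sigma_algebra.
  by move/continuousP: cf; exact.
exact: (smallest_sub S1 sub).
Qed.

Lemma borel_open (T : topologicalType) (B : set T) : open B -> borel B.
Proof. exact: sub_sigma_algebra. Qed.

Lemma borelI (T : ptopologicalType) (B C : set T) :
  borel B -> borel C -> borel (B `&` C).
Proof.
by move=> bB bC; apply: (@measurableI _ (g_sigma_algebraType (@open T)) B C).
Qed.

Lemma borel_closed (T : ptopologicalType) (B : set T) : closed B -> borel B.
Proof.
move=> /closed_openC /borel_open oB; rewrite -[B]setCK.
exact: (@measurableC _ (g_sigma_algebraType (@open T)) _).
Qed.

Lemma mx_coord_continuous (T : topologicalType) k d i j :
  continuous (fun M : 'M[T]_(k, d) => M i j).
Proof.
move=> M B /= MB; exists (fun i' j' => [set y | (i', j') = (i, j) -> B y]).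
  move=> i' j'; have [[-> ->]|ne] := pselect ((i', j') = (i, j)).
    by apply: filterS MB => y By _.
  by apply: filterS filterT => y _ /ne.
by move=> N; exact.
Qed.

Lemma mx_continuous (S T : topologicalType) k d (f : S -> 'M[T]_(k, d)) :
  (forall i j, continuous (fun x => f x i j)) -> continuous f.
Proof.
move=> cf x B [Q Qf QB]; apply: filterS QB _.
apply: filter_forall => i; apply: filter_forall => j.
exact: (cf i j x).
Qed.

Lemma row_continuous (T : topologicalType) k d (i : 'I_k) :
  continuous (fun M : 'M[T]_(k, d) => row i M).
Proof.
apply: mx_continuous => i' j; under eq_fun do rewrite mxE.
exact: mx_coord_continuous.
Qed.

Section Thickening.
Context {R : realType} {T : pseudoMetricType R}.
Implicit Types (F : set T) (e : R) (x y : T).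

(** The balls of a pseudometric space need not be open; interiors are taken so
    that thickenings are Borel sets. *)
Definition thicken F e : set T := \bigcup_(x in F) (ball x e)°.

Lemma open_thicken F e : open (thicken F e).
Proof. by apply: bigcup_open => x _; exact: open_interior. Qed.

Lemma interior_ballW x y e e' : e < e' -> ball x e y -> (ball x e')° y.
Proof.
move=> ee' xy; apply/nbhs_ballP; exists (e' - e) => /=; first by rewrite subr_gt0.
by move=> z yz; rewrite -(subrKC e e'); exact: ball_triangle xy yz.
Qed.

Lemma thicken_ball F x y e e' : e < e' -> F x -> ball x e y -> thicken F e' y.
Proof. by move=> ee' Fx xy; exists x => //; exact: interior_ballW xy. Qed.

Lemma thicken_exists F e y : thicken F e y -> exists2 x, F x & ball x e y.
Proof. by case=> x Fx /interior_subset xy; exists x. Qed.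

Lemma le_thicken F e e' : e <= e' -> thicken F e `<=` thicken F e'.
Proof.
move=> ee' y [x Fx xy]; exists x => //.
by move: xy; apply: interiorS => z; exact: le_ball.
Qed.

Lemma sub_thicken F e : 0 < e -> F `<=` thicken F e.
Proof.
move=> e0 x Fx; apply: (thicken_ball (e := e / 2) _ Fx); first by lra.
by apply: ballxx; lra.
Qed.

Lemma bigcap_thicken F (c : R) : 0 < c -> closed F ->
  \bigcap_n thicken F (c / n.+1%:R) = F.
Proof.
move=> c0 cF; apply/seteqP; split => [x xF|x Fx n _]; last first.
  by apply: sub_thicken Fx; rewrite divr_gt0.
apply: cF => B /nbhs_ballP[e /= e0 eB].
have [n] := ltr_add_invr (divr_gt0 e0 c0); rewrite add0r => en.
have [y Fy /ball_sym xy] := thicken_exists (xF n I).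
exists y; split => //; apply: eB; apply: le_ball xy.
by rewrite mulrC -ler_pdivlMr// ltW.
Qed.

Lemma thicken_nonincreasing F (c : R) : 0 < c ->
  nonincreasing_seq (fun n => thicken F (c / n.+1%:R)).
Proof.
move=> c0 n p np; apply/subsetPset; apply: le_thicken.
apply: ler_wpM2l; first exact: ltW.
by rewrite lef_pV2 ?posrE ?ltr0n// ler_nat.
Qed.

(** A thickening contains a uniform neighbourhood of any smaller one, so that a
    Urysohn function separates the latter from the complement of the former. *)
Lemma thicken_separator F e : 0 < e -> exists f : T -> R,
  [/\ continuous f, forall x, 0 <= f x <= 1,
      forall x, thicken F (e / 2) x -> f x = 1 &
      forall x, ~ thicken F e x -> f x = 0].
Proof.
move=> e0; have : uniform_separator (~` thicken F e) (thicken F (e / 2)).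
  apply: uniform_separatorW.
  have e4 : 0 < e / 4 by lra.
  exists [set xy : T * T | ball xy.1 (PosNum e4)%:num xy.2].
    exact: entourage_ball.
  rewrite -subset0 => -[x y] /= [[nx /thicken_exists[z Fz zy]] xy].
  apply: nx; apply: (thicken_ball (e := e / 2 + e / 4) _ Fz); first by lra.
  exact: ball_triangle zy (ball_sym xy).
move=> /(@uniform_separatorP _ R)[f [cf f01 f0 f1]]; exists f; split => //.
- by move=> x; have /= := f01 (f x) ltac:(by exists x); rewrite in_itv.
- by move=> x xF; apply: f1; exists x.
- by move=> x xF; apply: f0; exists x.
Qed.

End Thickening.

(** * Measurability of finite windows of the sequence *)

Lemma continuous_comp_measurable disp (Om : measurableType disp) (R : realType)
    (T : topologicalType) (phi : Om -> T) (F : T -> R) :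
  (forall O, open O -> measurable (phi @^-1` O)) -> continuous F ->
  measurable_fun setT (F \o phi).
Proof.
move=> mphi /continuousP cF; apply: (measurability _ (measurable_realfun.RGenOpens.measurableE R)).
move=> _ [_ [a [b ->]] <-]; rewrite setTI comp_preimage; apply: mphi.
exact/cF/interval_open.
Qed.

Lemma embed_continuous (R : realType) k d (c : R) :
  continuous (fun M : 'M[R]_(k, d) => embed_mx (c *: M)).
Proof.
apply: mx_continuous => i j; under eq_fun do rewrite !mxE.
move=> M; apply: (@cvg_EFin _ _ (nbhs M)); first by near=> N.
have : (fun N : 'M[R]_(k, d) => c * N i j) @ M --> c * M i j.
  have H := @mx_coord_continuous R k d i j M.
  by apply: (continuous_comp H); exact: mulrl_continuous.
exact.
Unshelve. all: by end_near. Qed.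

Section Window.
Context {disp : measure_display} {Om : measurableType disp} {R : realType}.
Context {d : nat}.
Variable X : int -> Om -> 'rV[R]_d.
Hypothesis X_random : random_vectors X.

(** The Borel sets of a finite power are generated by countably many boxes, so
    that the joint measurability of a window follows from that of each
    vector. *)
Lemma measurable_sample k (u : 'I_k -> int) (B : set 'M[R]_(k, d)) :
  borel B -> measurable (sample X u @^-1` B).
Proof.
pose W := [set B : set 'M[R]_(k, d) | measurable (sample X u @^-1` B)].
have SW : sigma_algebra setT W.
  rewrite /W; split=> /=; first by rewrite preimage_set0.
  - by move=> C sC; rewrite setTD preimage_setC; exact: measurableC.
  - by move=> F sF; rewrite preimage_bigcup; exact: bigcupT_measurable.
have OW : @open _ `<=` W.
  move=> O oO; rewrite /W/=.
  pose box (q : 'M[rat]_(k, d) * nat) : set 'M[R]_(k, d) :=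
    [set M | forall i j, `|M i j - ratr (q.1 i j)| < q.2.+1%:R^-1].
  pose F q := if pselect (box q `<=` O) then sample X u @^-1` box q else set0.
  have mF q : measurable (F q).
    rewrite /F; case: (pselect (box q `<=` O)) => ? /=; last exact: measurable0.
    have -> : sample X u @^-1` box q = \bigcap_(ij in [set: 'I_k * 'I_d])
        (X (u ij.1) @^-1` [set v | `|v 0 ij.2 - ratr (q.1 ij.1 ij.2)| < q.2.+1%:R^-1]).
      apply/seteqP; split => w /=.
        by move=> H ij _; have /= := H ij.1 ij.2; rewrite mxE.
      by move=> H i j; have /= := H (i, j) I; rewrite mxE.
    apply: fin_bigcap_measurable; first exact: finite_finset.
    move=> [i j] _ /=; apply: X_random; apply: borel_open.
    have cc : continuous (fun v : 'rV[R]_d => v 0 j) by exact: mx_coord_continuous.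
    have oB : open ((fun v : 'rV[R]_d => v 0 j) @^-1`
                    ball (ratr (q.1 i j) : R) q.2.+1%:R^-1).
      by move/continuousP: cc; apply; exact: ball_open.
    apply: (eq_ind _ (@open _) oB).
    by apply/seteqP; split => v; rewrite /= /ball/= distrC.
  rewrite [X in measurable X](_ : _ = \bigcup_q F q).
    apply: countable_bigcupT_measurable; last exact: mF.
    exact: countableP.
  apply/seteqP; split => [w Ow|w [q _]]; last first.
    by rewrite /F; case: (pselect (box q `<=` O)) => // sO /= /sO.
  have /nbhs_ballP[e /= e0 eO] : nbhs (sample X u w) O by exact: open_nbhs_nbhs.
  have [n] := ltr_add_invr (ltac:(lra) : (0 : R) < e / 2); rewrite add0r => ne.
  have rq i j : {q : rat | `|sample X u w i j - ratr q| < n.+1%:R^-1 :> R}.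
    apply: cid; set y := sample X u w i j; set e' := n.+1%:R^-1.
    have e'0 : 0 < e' by rewrite invr_gt0.
    have ye : y - e' < y + e' by lra.
    have [q] := rat_in_itvoo ye; rewrite in_itv/= => /andP[q1 q2]; exists q.
    by rewrite ltr_norml; apply/andP; split; lra.
  exists (\matrix_(i, j) sval (rq i j), n) => //.
  rewrite /F; case: (pselect (box _ `<=` O)) => [?|[]] /=.
    by move=> i j /=; rewrite [X in ratr X]mxE; exact: (svalP (rq i j)).
  move=> M boxM; apply: eO; split => // i j.
  have := boxM i j; rewrite /= [X in ratr X]mxE.
  have := svalP (rq i j); set q := sval _ => H1 H2.
  rewrite /ball/=; move: ne H1 H2; move: n.+1%:R^-1 => e' ne.
  rewrite !ltr_norml => /andP[? ?] /andP[? ?].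
  by apply/andP; split; lra.
exact: (smallest_sub SW OW).
Qed.

Lemma measurable_sample_fun k (u : 'I_k -> int) (F : 'M[R]_(k, d) -> R) :
  continuous F -> measurable_fun setT (F \o sample X u).
Proof.
apply: continuous_comp_measurable => O oO.
by apply: measurable_sample; exact: borel_open.
Qed.

End Window.

(** * Vague convergence on continuity sets *)

Section VagueApproximation.
Context {R : realType} {k d : nat}.
Variable mu : {measure set (bxmx R k d) -> \bar R}.
Hypothesis mu_radon : radon_off_zero mu.
Implicit Types (F U : set (xmx R k d)) (f : xmx R k d -> R).

Lemma borel_thicken F (e : R) : borel (thicken F e).
Proof. by apply: borel_open; exact: open_thicken. Qed.

Lemma measurable_vague_test f :
  continuous f -> measurable_fun [set: bxmx R k d] (f : bxmx R k d -> R).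
Proof.
exact: (@continuous_comp_measurable _ (bxmx R k d) R (xmx R k d) id f
  (@borel_open _)).
Qed.

Lemma thicken_away F : closed F -> ~ F (xorigin : xmx R k d) ->
  exists2 c : R, 0 < c & bounded_away_from_zero (thicken F c).
Proof.
move=> cF F0.
have : nbhs (xorigin : xmx R k d) (~` F).
  by apply: open_nbhs_nbhs; split => //; exact: closed_openC.
move=> /nbhs_ballP[e /= e0 eF]; exists (e / 2) => [|cl0]; first by lra.
have e4 : 0 < e / 4 by lra.
have [y [/thicken_exists[x Fx xy] y0]] := cl0 _ (nbhsx_ballx _ _ e4).
apply: eF Fx; apply: (@le_ball _ _ _ (e / 4 + e / 2)); first by lra.
exact: ball_triangle y0 (ball_sym xy).
Qed.

(** The support avoids a neighbourhood of the origin, so its measure is finite. *)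
Lemma integral_vague_test_fin f : vague_test f -> (forall M, 0 <= f M <= 1) ->
  (0 <= \int[mu]_M (f M)%:E < +oo)%E.
Proof.
move=> [cf f0] f01.
apply/andP; split; first by apply: integral_ge0 => M _; rewrite lee_fin; case/andP: (f01 M).
pose B : set (xmx R k d) := f @^-1` ~` [set 0].
have oB : open B.
  move/continuousP: cf; apply; apply: closed_openC.
  by apply: accessible_closed_set1; apply: hausdorff_accessible; exact: Rhausdorff.
have B0 : bounded_away_from_zero B.
  by move=> clB; have [M [fM0 fM]] := clB _ f0; exact: fM0 fM.
apply: (@le_lt_trans _ _ (mu B)); last by apply: mu_radon.2 => //; exact: borel_open.
have mB : measurable (B : set (bxmx R k d)) by exact: borel_open.
have -> : mu B = (\int[mu]_M (\1_B M)%:E)%E by rewrite integral_indic// setIT.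
apply: ge0_le_integral => //.
- by move=> M _; rewrite lee_fin; case/andP: (f01 M).
- by apply/measurable_realfun.measurable_EFinP; exact: measurable_vague_test.
- by apply/measurable_realfun.measurable_EFinP; exact: measurable_realfun.measurable_indic.
- move=> M _; rewrite lee_fin indicE; case: (boolP (M \in B)) => [_|].
    by case/andP: (f01 M).
  by rewrite notin_setE /B/= => /contrapT ->.
Qed.

(** Thickenings of a closed set decrease to it, with finite measure from some
    point on; a test function squeezed between two of them has an integral close
    to the measure of the set. It equals one on a whole thickening, which leaves
    room for a change of normalization. *)
Lemma vague_above F (dlt : R) : closed F -> ~ F xorigin -> 0 < dlt ->
  exists (e : R) f, [/\ 0 < e, vague_test f, forall M, 0 <= f M <= 1,
    forall M, thicken F e M -> f M = 1 &
    (\int[mu]_M (f M)%:E <= mu F + dlt%:E)%E].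
Proof.
move=> cF F0 dlt0; have [c c0 cFc] := thicken_away cF F0.
have mF : measurable (F : set (bxmx R k d)) by exact: borel_closed.
have muF : mu F \is a fin_num.
  rewrite ge0_fin_numE//; apply: mu_radon.2 mF _ => cl0; apply: F0; exact: cF.
pose G n := thicken F (c / n.+1%:R).
have GF : (mu \o G) @ \oo --> mu F.
  have <- : \bigcap_n G n = F by exact: bigcap_thicken.
  apply: (@nonincreasing_cvg_mu _ (bxmx R k d)).
  - by apply: mu_radon.2; [exact: borel_thicken|rewrite /G divr1].
  - by move=> n; exact: borel_thicken.
  - by rewrite bigcap_thicken.
  - exact: thicken_nonincreasing.
have [n Gn] : exists n, (mu (G n) < mu F + dlt%:E)%E.
  apply: contrapT => /forallNP H.
  have : (mu F + dlt%:E <= mu F)%E.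
    by apply: cvge_ge GF; near=> n; rewrite leNgt; apply/negP; exact: H.
  by rewrite -[leRHS]adde0 leeD2lE// lee_fin leNgt dlt0.
have cn0 : 0 < c / n.+1%:R by rewrite divr_gt0.
have [f [cf f01 f1 f0]] := thicken_separator F cn0.
exists (c / n.+1%:R / 2), f; split => //; first by rewrite divr_gt0.
  split => //.
  have := cFc; rewrite /bounded_away_from_zero => ncl.
  have : nbhs (xorigin : xmx R k d) (~` closure (thicken F c)).
    by apply: open_nbhs_nbhs; split => //; apply: closed_openC; exact: closed_closure.
  apply: filterS => M nM; apply: f0 => /subset_closure FM; apply: nM.
  apply: closure_subset FM; apply: le_thicken.
  by rewrite ler_pdivrMr// ler_peMr ?ler1n// ltW.
apply: le_trans (ltW Gn).
have mG : measurable (G n : set (bxmx R k d)) by exact: borel_thicken.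
have -> : mu (G n) = (\int[mu]_M (\1_(G n) M)%:E)%E.
  by rewrite integral_indic// setIT.
apply: ge0_le_integral => //.
- by move=> M _; rewrite lee_fin; case/andP: (f01 M).
- by apply/measurable_realfun.measurable_EFinP; exact: measurable_vague_test.
- by apply/measurable_realfun.measurable_EFinP; exact: measurable_realfun.measurable_indic.
- move=> M _; rewrite lee_fin indicE; case: (boolP (M \in G n)) => [_|].
    by case/andP: (f01 M).
  by rewrite notin_setE => /f0 ->.
Unshelve. all: by end_near. Qed.

(** Dual to [vague_above]: the thickenings of the complement decrease to it, and
    one minus a separating function vanishes near the origin because the origin
    is interior to the complement. *)
Lemma vague_below U (b : R) : open U -> ~ closure U xorigin ->
  (b%:E < mu U)%E ->
  exists (e : R) f, [/\ 0 < e, vague_test f, forall M, 0 <= f M <= 1,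
    forall M, thicken (~` U) e M -> f M = 0 &
    (b%:E <= \int[mu]_M (f M)%:E)%E].
Proof.
move=> oU U0 bU; have cU : closed (~` U) by exact: open_closedC.
pose G n := ~` thicken (~` U) (1 / n.+1%:R) : set (xmx R k d).
have mU : measurable (U : set (bxmx R k d)) by exact: borel_open.
have mG n : measurable (G n : set (bxmx R k d)).
  by apply: borel_closed; exact/open_closedC/open_thicken.
have GU : \bigcup_n G n = U.
  by rewrite /G -setC_bigcap bigcap_thicken ?setCK.
have cvgG : (mu \o G) @ \oo --> mu U.
  rewrite -GU; apply: (@nondecreasing_cvg_mu _ (bxmx R k d)) => //.
    by rewrite GU.
  move=> n p np; apply/subsetPset/subsetC/subsetPset.
  exact: (thicken_nonincreasing _ ltr01).
have [n Gn] : exists n, (b%:E < mu (G n))%E.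
  apply: contrapT => /forallNP H.
  have : (mu U <= b%:E)%E.
    by apply: cvge_le cvgG; near=> n; rewrite leNgt; apply/negP; exact: H.
  by rewrite leNgt bU.
have n0 : 0 < 1 / n.+1%:R :> R by rewrite divr_gt0.
have [g [cg g01 g1 g0]] := thicken_separator (~` U) n0.
have cf : continuous (fun M => 1 - g M).
  move=> M; have c1 := @cst_continuous (xmx R k d) R 1 M.
  exact: (continuousB c1 (cg M)).
have f01 M : 0 <= 1 - g M <= 1.
  by have /andP[? ?] := g01 M; apply/andP; split; lra.
exists (1 / n.+1%:R / 2), (fun M => 1 - g M); split => //.
- split => //.
  have : nbhs (xorigin : xmx R k d) (thicken (~` U) (1 / n.+1%:R / 2)).
    apply: open_nbhs_nbhs; split; first exact: open_thicken.
    apply: sub_thicken; first by rewrite divr_gt0.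
    by move=> UM; apply: U0; exact: subset_closure.
  by apply: filterS => M /g1 ->; rewrite subrr.
- by move=> M /g1 ->; rewrite subrr.
apply: (le_trans (ltW Gn)).
have -> : mu (G n) = (\int[mu]_M (\1_(G n) M)%:E)%E.
  by rewrite integral_indic// setIT.
apply: ge0_le_integral => //.
- by apply/measurable_realfun.measurable_EFinP; exact: measurable_realfun.measurable_indic.
- by apply/measurable_realfun.measurable_EFinP; exact: (measurable_vague_test cf).
- move=> M _; rewrite lee_fin indicE; case: (boolP (M \in G n)) => [|_].
    by rewrite inE => nM; rewrite (g0 _ nM) subr0.
  by have /andP[] := f01 M.
Unshelve. all: by end_near. Qed.

End VagueApproximation.

(** * Consequences of regular variation *)

Section ScalingBall.
Context {R : realType} {k d : nat}.

(** In the compactified distance scaling is uniformly close to the identity over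
    the whole line, although it is not for the usual distance. *)
Lemma contract_scale (c r : R) : 0 < c ->
  `|contract (c * r)%:E - contract r%:E| <= `|c - 1|.
Proof.
move=> c0; rewrite /contract normrM (gtr0_norm c0).
have r0 := normr_ge0 r; have cr0 : 0 <= c * `|r| by rewrite mulr_ge0// ltW.
have d1 : 0 < 1 + `|r| by lra.
have d2 : 0 < 1 + c * `|r| by lra.
have -> : c * r / (1 + c * `|r|) - r / (1 + `|r|) =
    (c - 1) * (r / ((1 + c * `|r|) * (1 + `|r|))).
  by field; apply/andP; split; apply: lt0r_neq0.
have dd : 0 < (1 + c * `|r|) * (1 + `|r|) by rewrite mulr_gt0.
rewrite normrM ler_piMr// normrM normfV (gtr0_norm dd) ler_pdivrMr//.
by nra.
Qed.

Lemma ball_embed_scale (x y e : R) (M : 'M[R]_(k, d)) :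
  0 < x -> 0 < y -> `|x / y - 1| < e ->
  ball (embed_mx (y^-1 *: M)) e (embed_mx (x^-1 *: M)).
Proof.
move=> x0 y0 xye; split => [|i j]; first exact: le_lt_trans xye.
rewrite !mxE; apply: le_lt_trans xye.
have -> : y^-1 * M i j = x / y * (x^-1 * M i j).
  by field; apply/andP; split; apply: lt0r_neq0.
by apply: contract_scale; rewrite divr_gt0.
Qed.

End ScalingBall.

Section RegularVariation.
Context {disp : measure_display} {Om : measurableType disp} {R : realType}.
Variable P : probability Om R.
Context {d : nat}.
Variable X : int -> Om -> 'rV[R]_d.
Variables (al : R) (a : nat -> R).
Variable mu : forall h : nat, {measure set (bxmx R h.+1 d) -> \bar R}.
Hypothesis X_random : random_vectors X.
Hypothesis X_regvar : regularly_varying P X al a mu.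

Definition window_event h (x : R) (B : set (xmx R h.+1 d)) : set Om :=
  [set w | B (embed_mx (x^-1 *: Yvec X h w))].

Lemma measurable_window_event h x (B : set (xmx R h.+1 d)) :
  borel B -> measurable (window_event x B).
Proof.
move=> /(borel_preimage (@embed_continuous R h.+1 d x^-1)).
exact: measurable_sample.
Qed.

Lemma measurable_window_test h x (f : xmx R h.+1 d -> R) : continuous f ->
  measurable_fun setT (fun w => f (embed_mx (x^-1 *: Yvec X h w))).
Proof.
move=> cf; have : continuous (f \o (fun M => embed_mx (x^-1 *: M))).
  by move=> M; apply: continuous_comp; [exact: embed_continuous|exact: cf].
exact: measurable_sample_fun.
Qed.

Lemma prob_fin (B : set Om) : measurable B -> P B \is a fin_num.
Proof. exact: fin_num_measure. Qed.

Section Portmanteau.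
Variables (h : nat) (N : nat -> nat).
Hypothesis N_infty : N k @[k --> \oo] --> \oo.

Let test_mean f k : \bar R :=
  (\int[P]_w (f (embed_mx ((a (N k))^-1 *: Yvec X h w)))%:E)%E.

Lemma test_mean_fin (f : xmx R h.+1 d -> R) k : continuous f -> (forall M, 0 <= f M <= 1) ->
  test_mean f k \is a fin_num.
Proof.
move=> cf f01.
have f01w w := f01 (embed_mx ((a (N k))^-1 *: Yvec X h w)).
rewrite ge0_fin_numE; last first.
  by apply: integral_ge0 => w _; have /andP[] := f01w w; rewrite lee_fin.
apply: (@le_lt_trans _ _ (\int[P]_w (cst 1%E w))%E).
  apply: ge0_le_integral => //.
  - by move=> w _; have /andP[] := f01w w; rewrite lee_fin.
  - by apply/measurable_realfun.measurable_EFinP; exact: measurable_window_test.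
  - by move=> w _; have /andP[] := f01w w; rewrite lee_fin.
by rewrite integral_cst//= probability_setT mule1 ltry.
Qed.

Lemma vague_real (f : xmx R h.+1 d -> R) : vague_test f -> (forall M, 0 <= f M <= 1) ->
  (N k)%:R * fine (test_mean f k) @[k --> \oo] -->
    fine (\int[mu h]_M (f M)%:E)%E.
Proof.
move=> vf f01.
have /andP[i0 ioo] := integral_vague_test_fin (rv_radon X_regvar h) vf f01.
have := rv_vague X_regvar vf.
rewrite -[X in _ --> X](@fineK _ (\int[mu h]_M (f M)%:E)%E) ?ge0_fin_numE//.
move=> H; have /fine_cvg := cvg_comp _ _ N_infty H.
rewrite (_ : fine \o _ = fun k => (N k)%:R * fine (test_mean f k))//.
by apply/funext => k; rewrite /= fineM//; exact: (test_mean_fin k vf.1 f01).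
Qed.

Variable x : nat -> R.
Hypothesis x_a : x k / a (N k) @[k --> \oo] --> (1 : R).

(** The closure and the interior have the same measure, and are approximated from
    outside and from inside by the integrals of test functions. These functions
    are constant on thickenings, which absorb the difference between the
    normalizations [x k] and [a (N k)]. *)
Lemma portmanteau (B : set (xmx R h.+1 d)) : borel B -> bounded_away_from_zero B ->
  continuity_set (mu h) B ->
  (mu h B < +oo)%E /\
  (N k)%:R * fine (P (window_event (x k) B)) @[k --> \oo] --> fine (mu h B).
Proof.
move=> bB B0 contB.
have radon := rv_radon X_regvar h.
have muB : (mu h B < +oo)%E by exact: radon.2.
split => //.
have mB : measurable (B : set (bxmx R h.+1 d)) by [].
have mF : measurable (closure B : set (bxmx R h.+1 d)).
  by apply: borel_closed; exact: closed_closure.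
have mU : measurable (B° : set (bxmx R h.+1 d)).
  by apply: borel_open; exact: open_interior.
have muFU : mu h (closure B) = mu h B°.
  apply/eqP; rewrite eq_le; apply/andP; split; last first.
    apply: le_measure; rewrite ?inE//.
    exact: subset_trans (@interior_subset _ B) (@subset_closure _ B).
  have -> : closure B = B° `|` boundary B.
    rewrite /boundary setUDr setDv setD0; apply/esym/setUidPr.
    exact: subset_trans (@interior_subset _ B) (@subset_closure _ B).
  apply: (le_trans (measureU2 _ _ _)) => //.
    exact: (measurableD mF mU).
  by rewrite -[leRHS]adde0; apply: leeD => //; apply: (eq_ind_r (fun y => (y <= 0)%E) _ contB).
have muBF : mu h (closure B) = mu h B.
  apply/eqP; rewrite eq_le; apply/andP; split; last first.
    by apply: le_measure; rewrite ?inE//; exact: subset_closure.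
  by rewrite muFU; apply: le_measure; rewrite ?inE//; exact: interior_subset.
have mp k : measurable (window_event (x k) B) by exact: measurable_window_event.
have a_gt0 : \forall k \near \oo, 0 < a (N k).
  have := cvg_comp _ _ N_infty (rv_infty X_regvar).
  by move=> /cvgryPgt/(_ 0).
have ball_near (e : R) : 0 < e -> \forall k \near \oo, forall w,
    ball (embed_mx ((a (N k))^-1 *: Yvec X h w)) e
         (embed_mx ((x k)^-1 *: Yvec X h w)).
  move=> e0; move/cvgrPdist_lt : x_a => xa; near=> k => w.
  have aN0 : 0 < a (N k) by near: k.
  have r1 : `|1 - x k / a (N k)| < Num.min e 1.
    by near: k; apply: xa; rewrite lt_min e0 ltr01.
  move: r1; rewrite lt_min => /andP[r1 r2].
  apply: ball_embed_scale => //; last by rewrite distrC.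
  move: r2; rewrite ltr_norml => /andP[_ r2].
  have : 0 < x k / a (N k) by lra.
  by rewrite pmulr_lgt0// invr_gt0.
apply/cvgrPdist_le => dlt dlt0.
have dlt2 : 0 < dlt / 2 by lra.
have [e [f [e0 vf f01 f1 fint]]] :=
  vague_above radon (@closed_closure _ B) B0 dlt2.
have bU : ((fine (mu h B) - dlt / 2)%:E < mu h B°)%E.
  by rewrite -muFU muBF -[ltRHS]fineK ?ge0_fin_numE// lte_fin; lra.
have U0 : ~ closure B° (xorigin : xmx R h.+1 d).
  by move=> c0; apply: B0; move: c0; apply: closure_subset; exact: interior_subset.
have [e' [g [e'0 vg g01 g1 gint]]] := vague_below (@open_interior _ B) U0 bU.
have /cvgrPdist_le/(_ _ dlt2) cvf := vague_real vf f01.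
have /cvgrPdist_le/(_ _ dlt2) cvg := vague_real vg g01.
have fint' : fine (\int[mu h]_M (f M)%:E)%E <= fine (mu h B) + dlt / 2.
  have /andP[i0 ioo] := integral_vague_test_fin radon vf f01.
  rewrite -lee_fin fineK ?ge0_fin_numE//; apply: (le_trans fint).
  by rewrite muBF EFinD fineK ?ge0_fin_numE.
have gint' : fine (mu h B) - dlt / 2 <= fine (\int[mu h]_M (g M)%:E)%E.
  have /andP[i0 ioo] := integral_vague_test_fin radon vg g01.
  by rewrite -lee_fin [leRHS]fineK ?ge0_fin_numE.
have e2 : 0 < e / 2 by lra.
have e'2 : 0 < e' / 2 by lra.
near=> k.
have b1 : forall w, ball (embed_mx ((a (N k))^-1 *: Yvec X h w)) (e / 2)
         (embed_mx ((x k)^-1 *: Yvec X h w)) by near: k; exact: ball_near.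
have b2 : forall w, ball (embed_mx ((a (N k))^-1 *: Yvec X h w)) (e' / 2)
         (embed_mx ((x k)^-1 *: Yvec X h w)) by near: k; exact: ball_near.
have pE : P (window_event (x k) B) =
    (\int[P]_w (\1_(window_event (x k) B) w)%:E)%E.
  by rewrite integral_indic// setIT.
have f01w w := f01 (embed_mx ((a (N k))^-1 *: Yvec X h w)).
have g01w w := g01 (embed_mx ((a (N k))^-1 *: Yvec X h w)).
have up : fine (P (window_event (x k) B)) <= fine (test_mean f k).
  apply: fine_le; [exact: prob_fin|exact: test_mean_fin vf.1 f01|].
  rewrite pE; apply: ge0_le_integral => //.
  - by apply/measurable_realfun.measurable_EFinP/measurable_realfun.measurable_indic.
  - by apply/measurable_realfun.measurable_EFinP; exact: measurable_window_test vf.1.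
  - move=> w _; rewrite lee_fin indicE.
    case: (boolP (w \in _)) => [|_]; last by have /andP[] := f01w w.
    rewrite inE => Bw; rewrite f1//.
    apply: (thicken_ball (e := e / 2) _ (subset_closure Bw)); first by lra.
    exact/ball_sym/b1.
have low : fine (test_mean g k) <= fine (P (window_event (x k) B)).
  apply: fine_le; [exact: test_mean_fin vg.1 g01|exact: prob_fin|].
  rewrite pE; apply: ge0_le_integral => //.
  - by move=> w _; have /andP[] := g01w w; rewrite lee_fin.
  - by apply/measurable_realfun.measurable_EFinP; exact: measurable_window_test vg.1.
  - by apply/measurable_realfun.measurable_EFinP/measurable_realfun.measurable_indic.
  - move=> w _; rewrite lee_fin indicE.
    case: (boolP (w \in _)) => [_|].
      by have /andP[] := g01w w.
    rewrite notin_setE => nB; rewrite g1//.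
    have nU : (~` B°) (embed_mx ((x k)^-1 *: Yvec X h w)).
      by move=> /interior_subset.
    apply: (thicken_ball (e := e' / 2) _ nU); first by lra.
    exact/ball_sym/b2.
have F1 : `|fine (\int[mu h]_M (f M)%:E)%E - (N k)%:R * fine (test_mean f k)| <= dlt / 2.
  by near: k.
have G1 : `|fine (\int[mu h]_M (g M)%:E)%E - (N k)%:R * fine (test_mean g k)| <= dlt / 2.
  by near: k.
have N0 := ler0n R (N k).
have up' := ler_wpM2l N0 up; have low' := ler_wpM2l N0 low.
move: F1 G1; rewrite !ler_norml => /andP[? ?] /andP[? ?].
by apply/andP; split; lra.
Unshelve. all: by end_near. Qed.

End Portmanteau.
End RegularVariation.

(** * Tails of the norm *)

Section ExtendedNorm.
Context {R : realType} {d : nat}.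
Implicit Types (c t s r : R) (y : \bar R) (M : xmx R 1 d) (v : 'rV[R]_d).

(** Truncating the squares makes the squared norm a continuous real function on
    the compactification; the truncation level is immaterial above the radius
    of the ball. *)
Definition trunc_sqr c y : R :=
  match y with r%:E => Num.min (c ^+ 2) (r ^+ 2) | _ => c ^+ 2 end.

Definition norm_gt t : set (xmx R 1 d) :=
  [set M | exists2 c, 0 < c & t ^+ 2 < \sum_j trunc_sqr c (M 0 j)].

Lemma trunc_sqr_ge0 c y : 0 <= trunc_sqr c y.
Proof. by case: y => [r| |] /=; rewrite ?le_min !sqr_ge0. Qed.

Lemma trunc_sqr_homo c c' y : 0 <= c -> c <= c' -> trunc_sqr c y <= trunc_sqr c' y.
Proof.
move=> c0 cc'; have c2 : c ^+ 2 <= c' ^+ 2 by rewrite lerXn2r ?nnegrE// (le_trans c0).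
case: y => [r| |] //=; rewrite le_min !ge_min lexx orbT andbT.
by rewrite c2.
Qed.

Lemma trunc_sqr_scale c t y : 0 < t ->
  trunc_sqr (t * c) (t%:E * y)%E = t ^+ 2 * trunc_sqr c y.
Proof.
move=> t0; case: y => [r| |] /=.
- by rewrite minr_pMr ?sqr_ge0// !exprMn.
- by rewrite gt0_muley ?lte_fin//= exprMn.
- by rewrite gt0_muleNy ?lte_fin//= exprMn.
Qed.

Lemma trunc_sqr_continuous c : continuous (trunc_sqr c).
Proof.
case=> [r| |].
- have cr : continuous (fun x : R => Num.min (c ^+ 2) (x ^+ 2)).
    move=> x; have c1 := @cst_continuous R R (c ^+ 2) x.
    exact: (continuous_min c1 (@exprn_continuous R 2 x)).
  move=> B /(cr r); rewrite /= => rB.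
  exact: rB.
- move=> B /= /nbhs_singleton cB.
  exists `|c|; split; first exact: num_real.
  case=> [x| |] //=; rewrite lte_fin => cx.
  rewrite (min_idPl _)//.
  by rewrite -[c ^+ 2]real_normK ?num_real// lerXn2r ?nnegrE// ltW// (le_lt_trans _ cx).
- move=> B /= /nbhs_singleton cB.
  exists (- `|c|); split; first exact: num_real.
  case=> [x| |] //=; rewrite lte_fin => cx.
  rewrite (min_idPl _)//.
  rewrite -[c ^+ 2]real_normK ?num_real// -[x ^+ 2]sqrrN.
  by rewrite lerXn2r ?nnegrE// ?ltW//; have := normr_ge0 c; lra.
Qed.

Lemma sum_trunc_sqr_continuous c :
  continuous (fun M : xmx R 1 d => \sum_j trunc_sqr c (M 0 j)).
Proof.
elim: (index_enum _) => [|j r IH] M.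
  rewrite (_ : (fun M => _) = cst 0); first exact: cst_continuous.
  by apply/funext => N; rewrite big_nil.
rewrite (_ : (fun M => _) = (fun N : xmx R 1 d => trunc_sqr c (N 0 j)) \+
    (fun N => \sum_(i <- r) trunc_sqr c (N 0 i))); last first.
  by apply/funext => N; rewrite big_cons.
have cj : {for M, continuous (fun N : xmx R 1 d => trunc_sqr c (N 0 j))}.
  apply: (@continuous_comp (xmx R 1 d) (\bar R) R (fun N => N 0 j) (trunc_sqr c)).
    exact: mx_coord_continuous.
  exact: trunc_sqr_continuous.
exact: (continuousD cj (IH M)).
Qed.

(** If some square reaches the truncation level the sum exceeds [t ^+ 2] anyway,
    and otherwise nothing is truncated. *)
Lemma norm_gt_cut c t M : 0 < t -> t < c ->
  norm_gt t M <-> t ^+ 2 < \sum_j trunc_sqr c (M 0 j).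
Proof.
move=> t0 tc; have c0 : 0 < c by exact: lt_trans tc.
split; last by exists c.
move=> [c' c'0 tc']; have [cc'|cc'] := leP c' c.
  by apply: (lt_le_trans tc'); apply: ler_sum => j _; exact: trunc_sqr_homo (ltW _) _.
have [[j jc]|nj] := pselect (exists j, c ^+ 2 <= trunc_sqr c (M 0 j)).
  apply: (@lt_le_trans _ _ (c ^+ 2)); first by rewrite ltrXn2r ?nnegrE ?ltW.
  rewrite (bigD1 j)//=; apply: (le_trans jc).
  by rewrite lerDl sumr_ge0// => i _; exact: trunc_sqr_ge0.
apply: (lt_le_trans tc'); apply: ler_sum => j _.
have : trunc_sqr c (M 0 j) < c ^+ 2 by rewrite ltNge; apply/negP => H; apply: nj; exists j.
case: (M 0 j) => [r| |] /=; rewrite ?ltxx// gt_min ltxx/= => rc.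
by rewrite (min_idPr (ltW rc)) ge_min lexx orbT.
Qed.

Lemma open_norm_gt t : 0 < t -> open (norm_gt t).
Proof.
move=> t0; have -> : norm_gt t =
    (fun M : xmx R 1 d => \sum_j trunc_sqr (t + 1) (M 0 j)) @^-1` [set x | t ^+ 2 < x].
  by apply/seteqP; split=> M; rewrite (@norm_gt_cut (t + 1))//; lra.
move/continuousP: (@sum_trunc_sqr_continuous (t + 1)); apply.
exact: open_gt.
Qed.

Lemma borel_norm_gt t : 0 < t -> borel (norm_gt t).
Proof. by move=> t0; apply: borel_open; exact: open_norm_gt. Qed.

Lemma closure_norm_gt s t : 0 < s -> s < t -> closure (norm_gt t) `<=` norm_gt s.
Proof.
move=> s0 st; have t0 : 0 < t by exact: lt_trans st.
pose F := (fun M : xmx R 1 d => \sum_j trunc_sqr (t + 1) (M 0 j)) @^-1` [set x | t ^+ 2 <= x].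
have cF : closed F.
  apply: closed_comp => [M _|]; first exact: sum_trunc_sqr_continuous.
  exact: closed_ge.
have tF : norm_gt t `<=` F.
  by move=> M; rewrite (@norm_gt_cut (t + 1))//; [exact: ltW|lra].
move=> M /(closure_subset tF)/cF; rewrite /F/= => tM.
exists (t + 1); first by lra.
by apply: lt_le_trans tM; rewrite ltrXn2r ?nnegrE ?ltW.
Qed.

Lemma norm_gt_embed t v : 0 < t -> norm_gt t (embed_mx v) <-> t < enorm v.
Proof.
move=> t0; rewrite /enorm.
have S0 : 0 <= \sum_(j < d) v 0 j ^+ 2 by apply: sumr_ge0 => j _; exact: sqr_ge0.
have tS : (t < Num.sqrt (\sum_(j < d) v 0 j ^+ 2)) = (t ^+ 2 < \sum_(j < d) v 0 j ^+ 2).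
  by rewrite -[LHS](@ltr_pXn2r _ 2) ?nnegrE ?sqrtr_ge0 ?ltW// sqr_sqrtr.
rewrite tS; split.
  move=> [c c0 tc]; apply: (lt_le_trans tc); apply: ler_sum => j _.
  by rewrite mxE/= ge_min lexx orbT.
move=> tv; exists (Num.sqrt (\sum_(j < d) v 0 j ^+ 2)).
  by rewrite sqrtr_gt0; apply: lt_trans tv; rewrite exprn_gt0.
apply: (lt_le_trans tv); apply: ler_sum => j _; rewrite mxE/= sqr_sqrtr//.
rewrite le_min lexx andbT (bigD1 j)//= lerDl.
by apply: sumr_ge0 => i _; exact: sqr_ge0.
Qed.

Lemma borel_enorm_gt t : 0 < t -> borel [set v : 'rV[R]_d | t < enorm v].
Proof.
move=> t0; have H := borel_preimage (@embed_continuous R 1 d 1) (borel_norm_gt t0).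
apply: (eq_ind _ (@borel _) H).
by apply/seteqP; split=> v /=; rewrite scale1r => /(norm_gt_embed v t0).
Qed.

Lemma norm_gt_away t : 0 < t -> bounded_away_from_zero (norm_gt t).
Proof.
move=> t0 cl0; have h0 : 0 < t / 2 by lra.
have ht : t / 2 < t by lra.
have [c c0] := closure_norm_gt h0 ht cl0.
rewrite big1 => [|j _].
  by rewrite ltNge sqr_ge0.
by rewrite mxE/= expr0n/=; apply/min_idPr; exact: sqr_ge0.
Qed.

Lemma norm_gt_dilation t : 0 < t -> norm_gt t = dilation t (norm_gt 1).
Proof.
move=> t0; have t_neq0 : t != 0 by exact: lt0r_neq0.
apply/seteqP; split=> M /=.
  move=> [c c0 tc]; exists (map_mx (fun y => (t^-1)%:E * y)%E M); last first.
    apply/matrixP => i j; rewrite !mxE muleA -EFinM divff//.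
    by rewrite mul1e.
  exists (t^-1 * c); first by rewrite mulr_gt0// invr_gt0.
  under eq_bigr do rewrite mxE trunc_sqr_scale ?invr_gt0//.
  rewrite -mulr_sumr expr1n exprVn mulrC ltr_pdivlMr ?exprn_gt0//.
  by rewrite mul1r.
move=> [M' [c c0 tc] <-]; exists (t * c); first by rewrite mulr_gt0.
under eq_bigr do rewrite mxE trunc_sqr_scale//.
by rewrite -mulr_sumr ltr_pMr ?exprn_gt0// -[ltLHS](expr1n _ 2).
Qed.

End ExtendedNorm.

(** * The extremogram as a ratio of limit measures *)

Definition both_ends {R : realType} {d : nat} (A : set (xmx R 1 d)) (h : nat) :
    set (xmx R h.+1 d) :=
  [set M | A (row ord0 M) /\ A (row ord_max M)].
Arguments both_ends {R d} A h _.

Section Extremogram.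
Context {disp : measure_display} {Om : measurableType disp} {R : realType}.
Variable P : probability Om R.
Context {d : nat}.
Variable X : int -> Om -> 'rV[R]_d.
Variables (al : R) (a : nat -> R).
Variable mu : forall h : nat, {measure set (bxmx R h.+1 d) -> \bar R}.
Hypothesis X_random : random_vectors X.
Hypothesis X_regvar : regularly_varying P X al a mu.

Let one_powR (r : R) : 1 `^ r = 1.
Proof. by rewrite powR1. Qed.

Let tail (x : R) : R := fine (P [set w | x < enorm (X 0 w)]).

Lemma Yvec0 w : Yvec X 0 w = X 0 w.
Proof. by apply/rowP => j; rewrite mxE. Qed.

Lemma enormZ (c : R) (v : 'rV[R]_d) : 0 < c -> enorm (c *: v) = c * enorm v.
Proof.
move=> c0; rewrite /enorm; under eq_bigr do rewrite mxE exprMn.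
by rewrite -mulr_sumr sqrtrM ?sqr_ge0// sqrtr_sqr gtr0_norm.
Qed.

Lemma norm_gt_event (x t : R) : 0 < x -> 0 < t ->
  window_event X x (norm_gt t) = [set w | t * x < enorm (X 0 w)].
Proof.
move=> x0 t0; apply/seteqP; split => w; rewrite /window_event /= Yvec0.
  by rewrite norm_gt_embed// enormZ ?invr_gt0// mulrC ltr_pdivlMr.
by move=> tx; apply/norm_gt_embed => //; rewrite enormZ ?invr_gt0// mulrC ltr_pdivlMr.
Qed.

Lemma measurable_tail_event (x : R) (t : int) : 0 < x ->
  measurable [set w | x < enorm (X t w)].
Proof. by move=> x0; exact: X_random (borel_enorm_gt x0). Qed.

Lemma tail_ge0 x : 0 <= tail x.
Proof. by apply: fine_ge0; exact: measure_ge0. Qed.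

Lemma tail_antitone x y : 0 < x -> x <= y -> tail y <= tail x.
Proof.
move=> x0 xy; have y0 : 0 < y by exact: lt_le_trans xy.
apply: fine_le; try (apply: fin_num_measure; exact: measurable_tail_event).
apply: le_measure; rewrite ?inE; try exact: measurable_tail_event.
by move=> w /=; exact: le_lt_trans.
Qed.

Let phi t : \bar R := mu 0%N (norm_gt t).

Lemma phi_fin t : 0 < t -> phi t \is a fin_num.
Proof.
move=> t0; rewrite ge0_fin_numE//; apply: (rv_radon X_regvar 0).2.
  exact: borel_norm_gt.
exact: norm_gt_away.
Qed.

Lemma phi_scale t : 0 < t -> phi t = ((t `^ (- al))%:E * phi 1)%E.
Proof.
move=> t0; rewrite {1}/phi norm_gt_dilation//.
by rewrite (rv_homogeneous X_regvar)//; exact: borel_norm_gt.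
Qed.

(** Homogeneity forces the limit measure not to charge spheres: the tail of the
    norm under it is a power function, hence continuous. *)
Lemma norm_gt_continuity t : 0 < t -> continuity_set (mu 0%N) (norm_gt t).
Proof.
move=> t0; have al0 := rv_index X_regvar.
have mV (s : R) : 0 < s -> measurable (norm_gt s : set (bxmx R 1 d)).
  by move=> s0; exact: borel_norm_gt.
have mB : measurable (boundary (norm_gt t) : set (bxmx R 1 d)).
  apply: (@measurableD _ (bxmx R 1 d)).
    by apply: borel_closed; exact: closed_closure.
  by apply: borel_open; exact: open_interior.
apply/eqP; rewrite eq_le measure_ge0 andbT; apply/lee_addgt0Pr => e e0.
rewrite add0e.
(* The radius s is such that phi s = (1 + e / p) * phi t, which exceeds phi t by
   less than e; adding one to phi t keeps p positive. *)
pose p := fine (phi t) + 1.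
have p0 : 0 < p by rewrite ltr_wpDl// fine_ge0.
pose v := 1 + e / p.
have ep0 : 0 < e / p by rewrite divr_gt0.
have v1 : 1 < v by rewrite /v; lra.
pose s := t * v `^ (- al^-1).
have vp0 : 0 < v `^ (- al^-1) by rewrite powR_gt0//; lra.
have s0 : 0 < s by rewrite mulr_gt0.
have st : s < t.
  rewrite /s -[ltRHS]mulr1 ltr_pM2l// powRN invf_lt1 ?powR_gt0//; last by lra.
  rewrite -[ltLHS](one_powR al^-1); apply: gt0_ltr_powR => //;
    by rewrite ?invr_gt0 ?nnegrE//; lra.
have phis : phi s = (v%:E * phi t)%E.
  rewrite phi_scale// [in RHS]phi_scale// muleA; congr (_ * _)%E.
  rewrite -EFinM; congr (_%:E).
  rewrite powRM ?ltW// mulrC; congr (_ * _).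
  rewrite -powRrM mulrNN mulVf ?gt_eqF// powRr1//; lra.
have sub : boundary (norm_gt t : set (xmx R 1 d)) `<=` norm_gt s `\` norm_gt t.
  move=> M [clM iM]; split; first exact: (closure_norm_gt s0 st clM).
  by move=> tM; apply: iM; apply: open_nbhs_nbhs; split => //; exact: open_norm_gt.
apply: (@le_trans _ _ (mu 0%N (norm_gt s `\` norm_gt t))).
  apply: le_measure; rewrite ?inE//.
  by apply: (@measurableD _ (bxmx R 1 d)); exact: mV.
have -> : (mu 0%N (norm_gt s `\` norm_gt t) = phi s - phi t)%E.
  have stE : norm_gt s `&` norm_gt t = norm_gt t :> set (bxmx R 1 d).
    by apply: setIidr => M tM; exact: (closure_norm_gt s0 st (subset_closure tM)).
  rewrite (_ : phi t = mu 0%N (norm_gt s `&` norm_gt t)); last by rewrite /phi stE.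
  apply: (@measureD _ (bxmx R 1 d)); [exact: mV|exact: mV|].
  by have := phi_fin s0; rewrite ge0_fin_numE.
rewrite phis -(fineK (phi_fin t0)) -EFinM -EFinB lee_fin.
rewrite -[X in _ - X]mul1r -mulrBl /v addrAC subrr add0r.
by rewrite mulrAC ler_pdivrMr// ler_wpM2l ?ltW// /p; lra.
Qed.

Lemma a_gt0_near (N : nat -> nat) : N k @[k --> \oo] --> \oo ->
  \forall k \near \oo, 0 < a (N k).
Proof.
by move=> /cvg_comp/(_ (rv_infty X_regvar)) /cvgryPgt/(_ 0).
Qed.

Lemma tail_cvg_phi (N : nat -> nat) t : N k @[k --> \oo] --> \oo -> 0 < t ->
  (N k)%:R * tail (t * a (N k)) @[k --> \oo] --> t `^ (- al) * fine (phi 1).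
Proof.
move=> Noo t0; have aN := a_gt0_near Noo.
have r1 : a (N k) / a (N k) @[k --> \oo] --> (1 : R).
  apply: cvg_near_cst; near=> k; rewrite divff// gt_eqF//.
  by near: k.
have [_] := portmanteau X_random X_regvar Noo r1
  (borel_norm_gt t0) (norm_gt_away t0) (norm_gt_continuity t0).
rewrite -/(phi t) phi_scale// fineM//; last exact: phi_fin.
apply: cvg_trans; apply: near_eq_cvg; near=> k.
by rewrite norm_gt_event//; near: k.
Unshelve. all: by end_near. Qed.

(** The tail of the norm normalizes the sequence [a], and with it the limit
    measure. *)
Lemma phi1 : fine (phi 1) = 1.
Proof.
have c1 := tail_cvg_phi (@cvg_id _ \oo) (@ltr01 R).
have /fine_cvg c2 := rv_norm X_regvar.
have -> : fine (phi 1) = 1 `^ (- al) * fine (phi 1) by rewrite powR1 mul1r.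
apply: (cvg_unique _ c1) => //.
apply: cvg_trans c2; apply: near_eq_cvg; near=> k.
have ak : 0 < a k by near: k; exact: a_gt0_near (@cvg_id _ \oo).
rewrite /= mul1r fineM//; apply: fin_num_measure; exact: measurable_tail_event.
Unshelve. all: by end_near. Qed.

Lemma tail_cvg (N : nat -> nat) t : N k @[k --> \oo] --> \oo -> 0 < t ->
  (N k)%:R * tail (t * a (N k)) @[k --> \oo] --> t `^ (- al).
Proof. by move=> Noo t0; have := tail_cvg_phi Noo t0; rewrite phi1 mulr1. Qed.

Lemma tail_gt0 x : 0 < x -> 0 < tail x.
Proof.
move=> x0; have c1 := tail_cvg (@cvg_id _ \oo) (@ltr01 R).
rewrite powR1 in c1.
have [k [ka kx]] : exists k, 1 / 2 < k%:R * tail (1 * a k) /\ x < a k.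
  have /cvgryPgt/(_ x) xa := rv_infty X_regvar.
  have /cvgrPdist_lt/(_ (1 / 2) ltac:(lra)) tk := c1.
  near \oo => k; exists k; split; last by near: k.
  have : `|1 - k%:R * tail (1 * a k)| < 1 / 2 by near: k.
  by rewrite ltr_norml => /andP[_]; lra.
apply: lt_le_trans (tail_antitone x0 (ltW kx)).
rewrite lt_neqAle tail_ge0 andbT; apply/eqP => t0.
by move: ka; rewrite [1 * a k]mul1r -t0 mulr0; lra.
Unshelve. all: by end_near. Qed.

Lemma tail_cvg0 (x : nat -> R) : x k @[k --> \oo] --> +oo ->
  tail (x k) @[k --> \oo] --> 0.
Proof.
move=> xoo; have c1 := tail_cvg (@cvg_id _ \oo) (@ltr01 R).
rewrite powR1 in c1.
apply/cvgr0Pnorm_le => e e0.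
have [n [n0 ne an]] : exists n, [/\ (0 < n)%N, tail (a n) <= e & 0 < a n].
  have /cvgrPdist_lt/(_ 1 ltac:(lra)) tk := c1.
  near \oo => n; exists n.
  have n0 : (0 < n)%N by near: n; exact: nbhs_infty_gt.
  split => //; last by near: n; exact: a_gt0_near (@cvg_id _ \oo).
  have : `|1 - n%:R * tail (1 * a n)| < 1 by near: n.
  rewrite mul1r ltr_norml => /andP[H _].
  have {}H : n%:R * tail (a n) < 2 by lra.
  rewrite -(ler_pM2l (_ : 0 < n%:R :> R)) ?ltr0n//.
  apply: (le_trans (ltW H)); rewrite -ler_pdivrMr//.
  by near: n; exact: nbhs_infty_ger.
move/cvgryPge : xoo => /(_ (a n)) xa.
near=> k; rewrite ger0_norm ?tail_ge0//.
by apply: (le_trans _ ne); apply: tail_antitone => //; near: k.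
Unshelve. all: by end_near. Qed.

(** Regular variation is known along the sequence [a] only. The integer part
    [N k] of the inverse of the tail at [x k] gives [(N k)%:R * tail (x k)] the
    limit one; as [(N k)%:R * tail (t * a (N k))] tends to [t `^ (- al)], which is
    less than one for [t > 1] and more than one for [t < 1], [x k] is caught
    between [(1 - e) * a (N k)] and [(1 + e) * a (N k)]. *)
Lemma normalization_index (x : nat -> R) : x k @[k --> \oo] --> +oo ->
  exists2 N : nat -> nat, N k @[k --> \oo] --> \oo &
    x k / a (N k) @[k --> \oo] --> (1 : R).
Proof.
move=> xoo; have al0 := rv_index X_regvar.
pose N k := Num.truncn (tail (x k))^-1.
have x_gt0 : \forall k \near \oo, 0 < x k by move/cvgryPgt : xoo; exact.
have t0 := tail_cvg0 xoo.
have Noo : N k @[k --> \oo] --> \oo.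
  apply/cvgnyPge => A; move/cvgr0Pnorm_lt : t0 => /(_ A.+1%:R^-1).
  rewrite invr_gt0 ltr0n => /(_ isT) tA.
  near=> k; have xk : 0 < x k by near: k.
  have tk : tail (x k) < A.+1%:R^-1.
    by rewrite -[ltLHS]ger0_norm ?tail_ge0//; near: k.
  rewrite /N truncn_ge_nat ?invr_ge0 ?tail_ge0//.
  move: tk; rewrite -[ltRHS]mul1r ltr_pdivlMr ?ltr0n// => tk.
  rewrite -[leRHS]mul1r ler_pdivlMr ?tail_gt0// mulrC; apply: le_trans (ltW tk).
  by rewrite ler_wpM2l ?tail_ge0// ler_nat.
have NT : (N k)%:R * tail (x k) @[k --> \oo] --> (1 : R).
  apply/cvgrPdist_le => e e0; move/cvgr0Pnorm_le : t0 => /(_ e e0) te.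
  near=> k; have xk : 0 < x k by near: k.
  have tk := tail_gt0 xk.
  have tke : tail (x k) <= e by rewrite -[leLHS]ger0_norm ?tail_ge0//; near: k.
  have N1 : (N k)%:R * tail (x k) <= 1.
    by rewrite -ler_pdivlMr// mul1r /N truncn_le invr_ge0 ltW.
  have N2 : 1 < (N k).+1%:R * tail (x k).
    by rewrite -ltr_pdivrMr// mul1r /N -truncn_le_nat.
  rewrite -natr1 mulrDl mul1r in N2.
  by rewrite ger0_norm; lra.
exists N => //; apply/cvgrPdist_le => e e0.
pose e' := Num.min e (1 / 2).
have e'0 : 0 < e' by rewrite lt_min e0/=; lra.
have e'1 : e' <= 1 / 2 by rewrite ge_min lexx orbT.
have e'e : e' <= e by rewrite ge_min lexx.
have up0 : 0 < 1 + e' by lra.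
have low0 : 0 < 1 - e' by lra.
have pup : (1 + e') `^ (- al) < 1.
  rewrite powRN invf_lt1 ?powR_gt0// -[ltLHS](one_powR al).
  by apply: gt0_ltr_powR => //; rewrite ?nnegrE//; lra.
have plow : 1 < (1 - e') `^ (- al).
  rewrite powRN invf_gt1 ?powR_gt0// -[ltRHS](one_powR al).
  by apply: gt0_ltr_powR => //; rewrite ?nnegrE//; lra.
have cup : \forall k \near \oo,
    0 < (N k)%:R * tail (x k) - (N k)%:R * tail ((1 + e') * a (N k)).
  have /cvgr_gt : (N k)%:R * tail (x k) - (N k)%:R * tail ((1 + e') * a (N k))
      @[k --> \oo] --> 1 - (1 + e') `^ (- al).
    by apply: cvgB => //; exact: tail_cvg.
  by apply; rewrite subr_gt0.
have clow : \forall k \near \oo,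
    0 < (N k)%:R * tail ((1 - e') * a (N k)) - (N k)%:R * tail (x k).
  have /cvgr_gt : (N k)%:R * tail ((1 - e') * a (N k)) - (N k)%:R * tail (x k)
      @[k --> \oo] --> (1 - e') `^ (- al) - 1.
    by apply: cvgB => //; exact: tail_cvg.
  by apply; rewrite subr_gt0.
have aN := a_gt0_near Noo.
near=> k.
have xk : 0 < x k by near: k.
have ak : 0 < a (N k) by near: k.
have H1 : 0 < (N k)%:R * tail (x k) - (N k)%:R * tail ((1 + e') * a (N k)).
  by near: k.
have H2 : 0 < (N k)%:R * tail ((1 - e') * a (N k)) - (N k)%:R * tail (x k).
  by near: k.
have N0 := ler0n R (N k).
have xup : x k < (1 + e') * a (N k).
  rewrite ltNge; apply/negP => /tail_antitone.
  rewrite mulr_gt0// => /(_ isT) /(ler_wpM2l N0); lra.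
have xlow : (1 - e') * a (N k) < x k.
  rewrite ltNge; apply/negP => /(tail_antitone xk) /(ler_wpM2l N0); lra.
have {}xup : x k / a (N k) < 1 + e' by rewrite ltr_pdivrMr.
have {}xlow : 1 - e' < x k / a (N k) by rewrite ltr_pdivlMr.
by rewrite ler_norml; apply/andP; split; lra.
Unshelve. all: by end_near. Qed.

Variable A : set (xmx R 1 d).
Hypothesis A_borel : borel A.
Hypothesis A_bounded : bounded_away_from_zero A.
Hypothesis A_cont0 : continuity_set (mu 0%N) A.
Hypothesis A_cont2 : forall h : nat, (1 <= h)%N ->
  continuity_set (mu h) [set M | A (row ord0 M) /\ A (row ord_max M)].
Hypothesis A_pos : (0 < mu 0%N A)%E.

Definition lag_limit h : R := fine (mu h (both_ends A h)).

Lemma both_ends0 : both_ends A 0 = A.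
Proof.
apply/seteqP; split=> M; rewrite /both_ends /= (_ : ord_max = ord0); try exact: ord1.
  by case=> + _; rewrite (_ : row ord0 M = M)//; apply/rowP => j; rewrite mxE.
by move=> AM; rewrite (_ : row ord0 M = M)//; apply/rowP => j; rewrite mxE.
Qed.

Lemma borel_both_ends h : borel (both_ends A h).
Proof.
apply: borelI.
  exact: (borel_preimage (@row_continuous (\bar R) h.+1 d ord0) A_borel).
exact: (borel_preimage (@row_continuous (\bar R) h.+1 d ord_max) A_borel).
Qed.

Lemma both_ends_away h : bounded_away_from_zero (both_ends A h).
Proof.
move=> cl0; apply: A_bounded => B B0.
have rc := @row_continuous (\bar R) h.+1 d ord0 (xorigin : xmx R h.+1 d).
have r0 : row ord0 (xorigin : xmx R h.+1 d) = xorigin.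
  by apply/matrixP => i j; rewrite !mxE.
have := rc B; rewrite /= r0 => /(_ B0) nB.
have [M [[AM _] BM]] := cl0 _ nB.
by exists (row ord0 M).
Qed.

Lemma both_ends_continuity h : continuity_set (mu h) (both_ends A h).
Proof. by case: h => [|h]; [rewrite both_ends0|exact: A_cont2]. Qed.

Lemma lag_limit0_gt0 : 0 < lag_limit 0.
Proof.
rewrite /lag_limit both_ends0; apply: fine_gt0; rewrite A_pos/=.
exact: (rv_radon X_regvar 0).2.
Qed.

Lemma exceeds_window h x :
  exceeds X A x h%:Z `&` exceeds X A x 0 = window_event X x (both_ends A h).
Proof.
have rowE (i : 'I_h.+1) w :
    row i (embed_mx (x^-1 *: Yvec X h w)) = embed_mx (x^-1 *: X (i : nat)%:Z w).
  by apply/rowP => j; rewrite !mxE.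
apply/seteqP; split => w; rewrite /window_event /both_ends /= !rowE.
  by case.
by case.
Qed.

Lemma measurable_exceeds x t : measurable (exceeds X A x t).
Proof.
have := borel_preimage (@embed_continuous R 1 d x^-1) A_borel.
exact: X_random.
Qed.

Lemma exceeds_cvg (N : nat -> nat) (x : nat -> R) h :
  N k @[k --> \oo] --> \oo -> x k / a (N k) @[k --> \oo] --> (1 : R) ->
  (N k)%:R * fine (P (exceeds X A (x k) h%:Z `&` exceeds X A (x k) 0))
    @[k --> \oo] --> lag_limit h.
Proof.
move=> Noo xa; have [_] := portmanteau X_random X_regvar Noo xa
  (@borel_both_ends h) (@both_ends_away h) (@both_ends_continuity h).
by under eq_fun do rewrite -exceeds_window.
Qed.

(** Along any sequence tending to infinity both probabilities, multiplied by the
    index of [normalization_index], converge; the index cancels in the ratio. *)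
Lemma extremogramE h : extremogram P X A h%:Z = lag_limit h / lag_limit 0.
Proof.
apply: cvg_lim => //; apply/cvg_pinftyP => x xoo.
have [N Noo xa] := normalization_index xoo.
have ch := @exceeds_cvg N x h Noo xa.
have c0 := @exceeds_cvg N x 0 Noo xa.
have l0 : lag_limit 0 != 0 by rewrite gt_eqF// lag_limit0_gt0.
have : ((N k)%:R * fine (P (exceeds X A (x k) h%:Z `&` exceeds X A (x k) 0))) *
    ((N k)%:R * fine (P (exceeds X A (x k) 0 `&` exceeds X A (x k) 0)))^-1
    @[k --> \oo] --> lag_limit h / lag_limit 0.
  by apply: cvgM => //; exact: (cvgV l0 c0).
apply: cvg_trans; apply: near_eq_cvg; near=> k.
have N0 : (N k)%:R != 0 :> R.
  rewrite pnatr_eq0 -lt0n; near: k; move/cvgnyPgt : Noo; exact.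
rewrite /= setIid invfM mulrACA divff// mul1r.
by [].
Unshelve. all: by end_near. Qed.

End Extremogram.

(** * Covariances of weighted sums of indicators *)

Section IndicatorSums.
Context {disp : measure_display} {Om : measurableType disp} {R : realType}.
Variable P : probability Om R.

Lemma integrable_indic_comb I (s : seq I) (c : I -> R) (F : I -> set Om) :
  (forall i, measurable (F i)) ->
  P.-integrable setT (fun w => (\sum_(i <- s) c i * \1_(F i) w)%:E).
Proof.
move=> mF; under eq_fun do rewrite -sumEFin.
apply: integrable_sum => // i _; under eq_fun do rewrite EFinM.
by apply: integrableZl => //; exact: integrable_indic.
Qed.

Lemma integral_indic_comb I (s : seq I) (c : I -> R) (F : I -> set Om) :
  (forall i, measurable (F i)) ->
  (\int[P]_w (\sum_(i <- s) c i * \1_(F i) w)%:E)%E =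
  (\sum_(i <- s) c i * fine (P (F i)))%:E.
Proof.
move=> mF; under eq_integral do rewrite -sumEFin.
rewrite integral_sum//; last first.
  move=> i; under eq_fun do rewrite EFinM.
  by apply: integrableZl => //; exact: integrable_indic.
rewrite -sumEFin; apply: eq_bigr => i _; under eq_integral do rewrite EFinM.
rewrite integralZl//; last exact: integrable_indic.
by rewrite integral_indic// setIT EFinM fineK// fin_num_measure.
Qed.

Variables (F : nat -> set Om) (p : R).
Hypothesis mF : forall t, measurable (F t).
Hypothesis Fp : forall t, fine (P (F t)) = p.

Lemma expectation_indicator_sum n (u : nat -> R) :
  ('E_P[fun w => (\sum_(1 <= t < n.+1) (\1_(F t) w - p) * u t)%R] = 0)%E.
Proof.
rewrite unlock.
have E w : \sum_(1 <= t < n.+1) (\1_(F t) w - p) * u t =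
    \sum_(t <- index_iota 1 n.+1) u t * \1_(F t) w +
    \sum_(t <- index_iota 1 n.+1) (- (p * u t)) * \1_[set: Om] w.
  rewrite -big_split/=; apply: eq_bigr => t _.
  by rewrite indicT /cst/=; ring.
under eq_integral do rewrite E EFinD.
rewrite integralD//; try exact: integrable_indic_comb.
rewrite !integral_indic_comb// -EFinD -big_split/= big1// => t _.
by rewrite Fp probability_setT /=; ring.
Qed.

Lemma covariance_indicator_sum n (u v : nat -> R) (K : R) :
  covariance P (fun w => K * \sum_(1 <= t < n.+1) (\1_(F t) w - p) * u t)
               (fun w => K * \sum_(1 <= t < n.+1) (\1_(F t) w - p) * v t) =
  (K ^+ 2 * \sum_(1 <= s < n.+1) \sum_(1 <= t < n.+1)
     (fine (P (F s `&` F t)) - p ^+ 2) * (u s * v t))%:E.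
Proof.
have E0 (x : nat -> R) :
    ('E_P[fun w => (K * \sum_(1 <= t < n.+1) (\1_(F t) w - p) * x t)%R] = 0)%E.
  rewrite -(expectation_indicator_sum n (fun t => K * x t)).
  congr expectation; apply/funext => w; rewrite mulr_sumr.
  by apply: eq_bigr => t _; ring.
rewrite unlock !E0/= unlock.
(* The product of two centred indicators is a combination of the indicators of
   the intersection, of each event and of the whole space. *)
pose c i j (k : 'I_4) : R := K ^+ 2 * (u i * v j) *
  nth 0 [:: 1; - p; - p; p ^+ 2] k.
pose G i j (k : 'I_4) := nth set0 [:: F i `&` F j; F i; F j; [set: Om]] k.
have mG i j k : measurable (G i j k).
  case: k => [[|[|[|[|//]]]]] ?; rewrite /G/=;
    [exact: measurableI|exact: mF|exact: mF|exact: measurableT].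
have E w : (K * \sum_(1 <= t < n.+1) (\1_(F t) w - p) * u t - 0) *
           (K * \sum_(1 <= t < n.+1) (\1_(F t) w - p) * v t - 0) =
    \sum_(1 <= i < n.+1) \sum_(1 <= j < n.+1) \sum_(k : 'I_4) c i j k * \1_(G i j k) w.
  rewrite !subr0 mulrACA mulr_suml mulr_sumr; apply: eq_bigr => i _.
  rewrite !mulr_sumr; apply: eq_bigr => j _.
  rewrite !big_ord_recl big_ord0 /c /G /= indicI indicT /cst/=.
  by ring.
transitivity (\int[P]_w (\sum_(1 <= i < n.+1)
    (\sum_(1 <= j < n.+1) \sum_(k : 'I_4) c i j k * \1_(G i j k) w)%:E))%E.
  by apply: eq_integral => w _; rewrite sumEFin; congr EFin; exact: E.
rewrite integral_sum//; last first.
  move=> i; under eq_fun do rewrite -sumEFin.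
  by apply: integrable_sum => // j _; exact: integrable_indic_comb.
rewrite mulr_sumr -sumEFin; apply: eq_bigr => i _.
under eq_integral do rewrite -sumEFin.
rewrite integral_sum//; last by move=> j; exact: integrable_indic_comb.
rewrite mulr_sumr -sumEFin; apply: eq_bigr => j _.
rewrite integral_indic_comb// !big_ord_recl big_ord0 /c /G /=.
rewrite probability_setT !Fp /=; congr (_%:E); ring.
Qed.

End IndicatorSums.

(** * Covariances of the exceedance indicators *)

Section Mixing.
Context {disp : measure_display} {Om : measurableType disp} {R : realType}.
Variable P : probability Om R.
Context {d : nat}.
Variable X : int -> Om -> 'rV[R]_d.
Hypothesis X_random : random_vectors X.

Lemma sigma_of_measurable (S : set int) C : sigma_of X S C -> measurable C.
Proof.
apply: smallest_sub; first exact: sigma_algebra_measurable.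
by move=> _ [t _ [B bB ->]]; exact: X_random.
Qed.

Lemma mixing_rateP h C D :
  sigma_of X [set t | t <= 0] C -> sigma_of X [set t | h%:Z <= t] D ->
  `|fine (P (C `&` D)) - fine (P C) * fine (P D)| <= mixing_rate P X h.
Proof.
move=> sC sD; apply: ub_le_sup; last by exists C => //; exists D.
exists 1 => _ [C' sC' [D' sD' <-]].
have mC := sigma_of_measurable sC'; have mD := sigma_of_measurable sD'.
have p01 (B : set Om) : measurable B -> 0 <= fine (P B) <= 1.
  move=> mB; rewrite fine_ge0//= -lee_fin fineK ?fin_num_measure//.
  exact: probability_le1.
have /andP[? ?] := p01 _ (measurableI _ _ mC mD).
have /andP[? ?] := p01 _ mC; have /andP[? ?] := p01 _ mD.
have : 0 <= fine (P C') * fine (P D') <= 1 by rewrite mulr_ge0//= mulr_ile1.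
by move=> /andP[? ?]; rewrite ler_norml; apply/andP; split; lra.
Qed.

Lemma mixing_rate_ge0 h : 0 <= mixing_rate P X h.
Proof.
apply: le_trans (@mixing_rateP h set0 set0 _ _); first exact: normr_ge0.
  exact: sigma_algebra0.
exact: sigma_algebra0.
Qed.

Hypothesis X_stationary : strictly_stationary P X.
Variable A : set (xmx R 1 d).
Hypothesis A_borel : borel A.

Lemma exceeds_shift x (s : int) (h : nat) :
  P (exceeds X A x s `&` exceeds X A x (h%:Z + s)) =
  P (exceeds X A x 0 `&` exceeds X A x h%:Z).
Proof.
pose u (i : 'I_2) : int := if i == ord0 then 0 else h%:Z.
pose B : set 'M[R]_(2, d) := [set M |
  A (embed_mx (x^-1 *: row ord0 M)) /\ A (embed_mx (x^-1 *: row ord_max M))].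
have bB : borel B.
  have bA := borel_preimage (@embed_continuous R 1 d x^-1) A_borel.
  apply: borelI.
    exact: (borel_preimage (@row_continuous R 2 d ord0) bA).
  exact: (borel_preimage (@row_continuous R 2 d ord_max) bA).
have rowE (u' : 'I_2 -> int) i w : row i (sample X u' w) = X (u' i) w.
  by apply/rowP => j; rewrite !mxE.
have eE (u' : 'I_2 -> int) : sample X u' @^-1` B =
    exceeds X A x (u' ord0) `&` exceeds X A x (u' ord_max).
  by apply/seteqP; split => w; rewrite /B /exceeds /= !rowE.
have := X_stationary u s bB; rewrite !eE /u /=.
by rewrite add0r.
Qed.

Lemma exceeds_stationary x (s : int) :
  P (exceeds X A x s) = P (exceeds X A x 0).
Proof.
rewrite -[exceeds X A x s]setIid -[exceeds X A x 0]setIid.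
by have := exceeds_shift x s 0; rewrite add0r.
Qed.

Lemma exceeds_sigma x (t : int) (S : set int) : S t ->
  sigma_of X S (exceeds X A x t).
Proof.
move=> St; apply: sub_sigma_algebra; exists t => //.
exists [set v | A (embed_mx (x^-1 *: v))] => //.
exact: (borel_preimage (@embed_continuous R 1 d x^-1) A_borel).
Qed.

Lemma exceeds_mixing x h :
  `|fine (P (exceeds X A x h%:Z `&` exceeds X A x 0)) -
    fine (P (exceeds X A x 0)) ^+ 2| <= mixing_rate P X h.
Proof.
rewrite setIC expr2 -{2}(exceeds_stationary x h%:Z).
by apply: mixing_rateP; apply: exceeds_sigma => /=.
Qed.

(** The anti-clustering condition is stated with the Euclidean norm, whereas being
    bounded away from zero is a topological condition; the compactified distance
    to the origin is at most the norm. *)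
Lemma exceeds_enorm : bounded_away_from_zero A ->
  exists2 eps : R, 0 < eps & forall x t, 0 < x ->
    exceeds X A x t `<=` [set w | eps * x < enorm (X t w)].
Proof.
move=> A0; have : nbhs (xorigin : xmx R 1 d) (~` closure A).
  apply: open_nbhs_nbhs; split => //.
  by apply: closed_openC; exact: closed_closure.
move=> /nbhs_ballP[e /= e0 eA]; exists (e / 2) => [|x t x0 w /= Aw]; first by lra.
rewrite ltNge; apply/negP => wx.
apply: (eA (embed_mx (x^-1 *: X t w))); last exact: subset_closure.
split => // i j; rewrite !mxE /ball/= /ereal_ball contract0 sub0r normrN.
set y := x^-1 * X t w i j.
have ye : `|y| < e.
  rewrite normrM gtr0_norm ?invr_gt0// mulrC ltr_pdivrMr//.
  apply: (@le_lt_trans _ _ (e / 2 * x)); last by nra.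
  apply: le_trans wx; rewrite /enorm -sqrtr_sqr (ord1 i) ler_wsqrtr//.
  by rewrite (bigD1 j)//= lerDl sumr_ge0// => k _; exact: sqr_ge0.
have y1 : 0 < 1 + `|y| by have := normr_ge0 y; lra.
rewrite /contract normrM normfV (gtr0_norm y1) ltr_pdivrMr//.
by have := normr_ge0 y; nra.
Qed.

Variables (al : R) (a : nat -> R).
Variable mu : forall h : nat, {measure set (bxmx R h.+1 d) -> \bar R}.
Variables m r : nat -> nat.
Hypothesis X_regvar : regularly_varying P X al a mu.
Hypothesis X_mixing : condition_M P X a m r.
Hypothesis A_bounded : bounded_away_from_zero A.
Hypothesis A_cont0 : continuity_set (mu 0%N) A.
Hypothesis A_cont2 : forall h : nat, (1 <= h)%N ->
  continuity_set (mu h) [set M | A (row ord0 M) /\ A (row ord_max M)].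

Let p n h : R :=
  fine (P (exceeds X A (a (m n)) h%:Z `&` exceeds X A (a (m n)) 0)).
Let p0 n : R := fine (P (exceeds X A (a (m n)) 0)).

Definition lag_covariance n h : R := (m n)%:R * (p n h - p0 n ^+ 2).

Let a_gt0 : \forall n \near \oo, 0 < a (m n).
Proof. exact: (a_gt0_near X_regvar (cM_m X_mixing)). Qed.

Let m_gt (K : R) : \forall n \near \oo, K < (m n)%:R.
Proof.
by have /cvgryPgt := cvg_comp _ _ (cM_m X_mixing) (@cvgr_idn R); exact.
Qed.

Lemma pair_cvg h : (m n)%:R * p n h @[n --> \oo] --> lag_limit mu A h.
Proof.
apply: (exceeds_cvg X_random X_regvar A_borel A_bounded A_cont0 A_cont2
  (N := m) (x := fun n => a (m n)) (cM_m X_mixing)).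
apply: cvg_near_cst; near=> n; rewrite divff// gt_eqF//; near: n.
exact: a_gt0.
Unshelve. all: by end_near. Qed.

Lemma single_cvg : (m n)%:R * p0 n @[n --> \oo] --> lag_limit mu A 0.
Proof. by have := @pair_cvg 0%N; under eq_fun do rewrite /p setIid. Qed.

Lemma m_inv_cvg0 : (m n)%:R^-1 @[n --> \oo] --> (0 : R).
Proof.
apply/gtr0_cvgV0; last exact: cvg_comp (cM_m X_mixing) (@cvgr_idn R).
exact: m_gt.
Qed.

(** The product of the means is negligible, being the square of a convergent
    sequence divided by [m n]. *)
Lemma lag_covariance_cvg h : lag_covariance n h @[n --> \oo] --> lag_limit mu A h.
Proof.
have sq : (m n)%:R^-1 * ((m n)%:R * p0 n) ^+ 2 @[n --> \oo] -->
    0 * (lag_limit mu A 0 * lag_limit mu A 0).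
  by apply: cvgM; [exact: m_inv_cvg0|apply: cvgM; exact: single_cvg].
have : (m n)%:R * p n h - (m n)%:R^-1 * ((m n)%:R * p0 n) ^+ 2 @[n --> \oo] -->
    lag_limit mu A h - 0 * (lag_limit mu A 0 * lag_limit mu A 0).
  by apply: cvgB => //; exact: pair_cvg.
rewrite mul0r subr0; apply: cvg_trans; apply: near_eq_cvg; near=> n.
have mn0 : (m n)%:R != 0 :> R by rewrite gt_eqF//; near: n; exact: m_gt.
by rewrite /lag_covariance; field.
Unshelve. all: by end_near. Qed.

Lemma p_ge0 n h : 0 <= p n h.
Proof. by apply: fine_ge0; exact: measure_ge0. Qed.

Lemma cluster_tail (e : R) : 0 < e -> exists k, \forall n \near \oo,
  \sum_(k <= h < (r n).+1) (m n)%:R * p n h <= e.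
Proof.
move=> e0; have [eps eps0 Aeps] := exceeds_enorm A_bounded.
pose Q n h : \bar R := P [set w | eps * a (m n) < enorm (X h%:Z w) /\
                                eps * a (m n) < enorm (X 0 w)].
pose u k n : \bar R := ((m n)%:R%:E * \sum_(k <= h < (r n).+1) Q n h)%E.
have H : limn_esup (u k) @[k --> \oo] --> 0%E := cM_cluster X_mixing eps0.
have : \forall k \near \oo, (limn_esup (u k) < e%:E)%E.
  by apply: (H [set y | (y < e%:E)%E]); exact: lt_nbhsl.
move=> [k _ /(_ k (leqnn k)) /= uk]; exists k.
move/ereal_inf_lt : uk => [_ [V V_oo <-] Ve].
near=> n; have Vn : V n by near: n.
have : (u k n < e%:E)%E.
  by apply: le_lt_trans Ve; apply: ereal_sup_ubound; exists n.
rewrite /u.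
have an0 : 0 < a (m n) by near: n; exact: a_gt0.
have mQ h : measurable [set w | eps * a (m n) < enorm (X h%:Z w) /\
                              eps * a (m n) < enorm (X 0 w)].
  apply: measurableI; apply: (measurable_tail_event X_random);
  by rewrite mulr_gt0.
have Qfin h : Q n h = (fine (Q n h))%:E by rewrite fineK// fin_num_measure.
rewrite (eq_bigr (fun h => (fine (Q n h))%:E)) => [|h _]; last exact: Qfin.
rewrite sumEFin -EFinM lte_fin => /ltW; apply: le_trans.
rewrite -mulr_sumr ler_wpM2l//; apply: ler_sum => h _.
apply: fine_le; [|by rewrite Qfin|].
  by apply: fin_num_measure; apply: measurableI; exact: measurable_exceeds.
apply: le_measure; rewrite ?inE//.
  by apply: measurableI; exact: measurable_exceeds.
by move=> w [/(Aeps _ _ an0) ? /(Aeps _ _ an0)].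
Unshelve. all: by end_near. Qed.

Lemma mixing_tail (e : R) : 0 < e -> \forall n \near \oo, forall N,
  \sum_(r n <= h < N) (m n)%:R * mixing_rate P X h <= e.
Proof.
move=> e0; pose u n : \bar R :=
  ((m n)%:R%:E * \sum_(r n <= h <oo) (mixing_rate P X h)%:E)%E.
have H : u n @[n --> \oo] --> 0%E := cM_tail X_mixing.
have ue : \forall n \near \oo, (u n < e%:E)%E.
  by apply: (H [set y | (y < e%:E)%E]); exact: lt_nbhsl.
near=> n => N; have un : (u n < e%:E)%E by near: n.
rewrite -mulr_sumr -lee_fin EFinM -sumEFin; apply: le_trans (ltW un).
rewrite /u; apply: lee_wpmul2l; first by rewrite lee_fin.
by apply: nneseries_lim_ge => h _ _; rewrite lee_fin mixing_rate_ge0.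
Unshelve. all: by end_near. Qed.

(** Up to lag [r n] the products of the means add up to a bounded sequence times
    [(r n).+1 / m n]. *)
Lemma square_tail (e : R) : 0 < e -> \forall n \near \oo,
  (r n).+1%:R * ((m n)%:R * p0 n ^+ 2) <= e.
Proof.
move=> e0.
have : ((r n)%:R / (m n)%:R + (m n)%:R^-1) * ((m n)%:R * p0 n) ^+ 2
    @[n --> \oo] --> (0 + 0) * (lag_limit mu A 0 * lag_limit mu A 0).
  apply: cvgM; last by apply: cvgM; exact: single_cvg.
  by apply: cvgD; [exact: (cM_rm X_mixing)|exact: m_inv_cvg0].
rewrite addr0 mul0r => /cvgr0Pnorm_le/(_ e e0) H; near=> n.
have mn0 : (m n)%:R != 0 :> R by rewrite gt_eqF//; near: n; exact: m_gt.
have : `|((r n)%:R / (m n)%:R + (m n)%:R^-1) * ((m n)%:R * p0 n) ^+ 2| <= e.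
  by near: n.
apply: le_trans; apply: le_trans (ler_norm _).
by rewrite -natr1 le_eqVlt; apply/orP; left; apply/eqP; field.
Unshelve. all: by end_near. Qed.

(** Up to lag [r n] joint exceedances are rare by the anti-clustering condition;
    beyond, the covariances are bounded by the mixing rate, whose tail sum is
    negligible. *)
Lemma lag_covariance_tail (e : R) : 0 < e -> exists k,
  \forall n \near \oo, \sum_(k <= h < n) `|lag_covariance n h| <= e.
Proof.
move=> e0; have e3 : 0 < e / 3 by lra.
have [k ck] := cluster_tail e3; exists k.
have mt := mixing_tail e3; have sq := square_tail e3.
near=> n.
have kr : (k <= (r n).+1)%N.
  apply: leqW; near: n; have /cvgnyPge := cM_r X_mixing; exact.
have H1 : \sum_(k <= h < (r n).+1) (m n)%:R * p n h <= e / 3 by near: n.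
have H2 : forall N, \sum_(r n <= h < N) (m n)%:R * mixing_rate P X h <= e / 3.
  by near: n.
have H3 : (r n).+1%:R * ((m n)%:R * p0 n ^+ 2) <= e / 3 by near: n.
have m0 := ler0n R (m n).
have near_lag : \sum_(k <= h < (r n).+1) `|lag_covariance n h| <= e / 3 + e / 3.
  apply: (@le_trans _ _ (\sum_(k <= h < (r n).+1)
      ((m n)%:R * p n h + (m n)%:R * p0 n ^+ 2))).
    apply: ler_sum => h _; rewrite /lag_covariance normrM ger0_norm// -mulrDr.
    rewrite ler_wpM2l//; apply: (le_trans (ler_normB _ _)).
    by rewrite !ger0_norm ?p_ge0 ?sqr_ge0.
  rewrite big_split/=; apply: lerD => //; apply: le_trans H3.
  set q := (m n)%:R * p0 n ^+ 2; rewrite sumr_const_nat -[q *+ _]mulr_natl.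
  by apply: ler_wpM2r; [rewrite mulr_ge0// sqr_ge0|rewrite ler_nat leq_subr].
have far_lag : \sum_((r n).+1 <= h < n) `|lag_covariance n h| <= e / 3.
  apply: le_trans (H2 n).
  have [rn|nr] := ltnP (r n) n; last first.
    rewrite big_geq; last by apply: leqW.
    by rewrite sumr_ge0// => h _; rewrite mulr_ge0// mixing_rate_ge0.
  rewrite [leRHS]big_ltn//.
  apply: (@le_trans _ _ (\sum_((r n).+1 <= h < n) (m n)%:R * mixing_rate P X h)).
    apply: ler_sum => h _; rewrite /lag_covariance normrM ger0_norm//.
    by rewrite ler_wpM2l// exceeds_mixing.
  by rewrite lerDr mulr_ge0// mixing_rate_ge0.
apply: (@le_trans _ _ (\sum_(k <= h < (r n).+1) `|lag_covariance n h| +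
    \sum_((r n).+1 <= h < n) `|lag_covariance n h|)); last by lra.
have [rn|nr] := leqP (r n).+1 n.
  by rewrite -[leRHS](@big_cat_nat _ _ _ (r n).+1).
rewrite [X in _ + X]big_geq 1?ltnW// addr0.
have [kn|nk] := leqP k n; last first.
  by rewrite big_geq 1?ltnW// sumr_ge0.
by rewrite [leRHS](@big_cat_nat _ _ _ n)//= 1?ltnW// lerDl sumr_ge0.
Unshelve. all: by end_near. Qed.

(** Cosine and sine weights give [alpha_n] and [beta_n]. *)
Definition weighted_sum (n : nat) (u : nat -> R) (w : Om) : R :=
  Num.sqrt (2 * (m n)%:R / n%:R) *
  \sum_(1 <= t < n.+1) centered_indicator P X A a m n t%:Z w * u t.

Lemma covariance_weighted_sum n u v :
  covariance P (weighted_sum n u) (weighted_sum n v) =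
  (2 / n%:R * \sum_(1 <= s < n.+1) \sum_(1 <= t < n.+1)
    (m n)%:R * (fine (P (exceeds X A (a (m n)) s%:Z `&`
                         exceeds X A (a (m n)) t%:Z)) - p0 n ^+ 2) *
    (u s * v t))%:E.
Proof.
have mF (t : nat) : measurable (exceeds X A (a (m n)) t%:Z).
  exact: measurable_exceeds.
have Fp (t : nat) : fine (P (exceeds X A (a (m n)) t%:Z)) = p0 n.
  by rewrite exceeds_stationary.
rewrite (covariance_indicator_sum mF Fp) sqr_sqrtr; last first.
  by rewrite !mulr_ge0 ?invr_ge0.
congr EFin; rewrite [2 * _ / _]mulrAC -[LHS]mulrA; congr (_ * _).
rewrite mulr_sumr; apply: eq_bigr => s _; rewrite mulr_sumr.
by apply: eq_bigr => t _; rewrite mulrA.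
Qed.

Lemma covariance_cvg (u v : nat -> nat -> R) (L : nat -> R) :
  (forall n t, `|u n t| <= 1) -> (forall n t, `|v n t| <= 1) ->
  (forall h, cross_average (u n) (v n) n h @[n --> \oo] --> L h) ->
  let l h := lag_weight h * lag_limit mu A h * L h in
  cvgn (fun N => \sum_(0 <= h < N) l h) /\
  covariance P (weighted_sum n (u n)) (weighted_sum n (v n)) @[n --> \oo] -->
    (limn (fun N => \sum_(0 <= h < N) l h))%:E.
Proof.
move=> u1 v1 uvL l.
pose G n s t := (m n)%:R * (fine (P (exceeds X A (a (m n)) s%:Z `&`
   exceeds X A (a (m n)) t%:Z)) - p0 n ^+ 2).
have Gc n (s t : nat) : (s <= t)%N -> G n s t = lag_covariance n (t - s)%N.
  move=> st; rewrite /G /lag_covariance /p; congr (_ * (fine _ - _)).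
  have -> : t%:Z = (t - s)%N%:Z + s%:Z by rewrite -PoszD subnK.
  by rewrite exceeds_shift setIC.
have Gsym n s t : G n s t = G n t s by rewrite /G setIC.
have [cl cvgG] := toeplitz_cvg Gc Gsym lag_covariance_cvg lag_covariance_tail
  u1 v1 uvL.
split => //; under eq_fun do rewrite covariance_weighted_sum.
exact: (cvg_comp _ _ cvgG).
Qed.

End Mixing.

(** * Frequencies *)

Section Frequencies.
Context {R : realType}.
Implicit Types (x y : R) (lam om : nat -> R).

Lemma fourier_sequenceD lam om :
  fourier_sequence lam -> fourier_sequence om -> fourier_sequence (lam \+ om).
Proof.
move=> Fl Fo; near=> n.
have [i iE] : fourier_frequency n (lam n) by near: n.
have [j jE] : fourier_frequency n (om n) by near: n.
exists (i + j); change (lam n + om n = 2 * pi * (i + j)%:~R / n%:R).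
by rewrite iE jE intrD; move: (2 * pi) n%:R^-1 => q z; ring.
Unshelve. all: by end_near. Qed.

Lemma fourier_sequenceB lam om :
  fourier_sequence lam -> fourier_sequence om -> fourier_sequence (lam \- om).
Proof.
move=> Fl Fo; near=> n.
have [i iE] : fourier_frequency n (lam n) by near: n.
have [j jE] : fourier_frequency n (om n) by near: n.
exists (i - j); change (lam n - om n = 2 * pi * (i - j)%:~R / n%:R).
by rewrite iE jE intrB; move: (2 * pi) n%:R^-1 => q z; ring.
Unshelve. all: by end_near. Qed.

Lemma equidistributed_pair lam om :
  (fourier_sequence lam /\ fourier_sequence om) \/
  (fixed_frequency lam /\ fixed_frequency om) ->
  equidistributed (lam \+ om) /\ equidistributed (lam \- om).
Proof.
case=> [[Fl Fo]|[]]; last move=> [l _ lE] [c _ cE].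
  by split; apply: equidistributed_fourier;
    [exact: fourier_sequenceD|exact: fourier_sequenceB].
have -> : lam = fun=> l by apply/funext.
have -> : om = fun=> c by apply/funext.
by split; exact: equidistributed_cst.
Qed.

Lemma resonance_aliased x y : ~ aliased x y ->
  resonance (x - y) = 0 /\ resonance (x + y) = 0.
Proof.
move=> nxy; split; rewrite /resonance; case: eqP => // /sin_eq0_mulpi[k kE];
  case: nxy; exists k; [left|right].
  have -> : x = y + 2 * ((x - y) / 2) by field.
  by rewrite kE mulrA.
have -> : x = - y + 2 * ((x + y) / 2) by field.
by rewrite kE mulrA.
Qed.

Lemma cross_average_cos_cos0 lam om h :
  equidistributed (lam \+ om) -> equidistributed (lam \- om) ->
  (\forall n \near \oo, ~ aliased (lam n) (om n)) ->
  cross_average (fun t => cos (lam n * t%:R)) (fun t => cos (om n * t%:R)) n h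
    @[n --> \oo] --> 0.
Proof.
move=> p q na; move: (@cross_average_cos_cos _ _ _ h p q).
apply: cvg_trans; apply: near_eq_cvg; near=> n.
have /resonance_aliased[-> ->] : ~ aliased (lam n) (om n) by near: n.
by rewrite addr0 !mul0r subr0.
Unshelve. all: by end_near. Qed.

Lemma cross_average_sin_sin0 lam om h :
  equidistributed (lam \+ om) -> equidistributed (lam \- om) ->
  (\forall n \near \oo, ~ aliased (lam n) (om n)) ->
  cross_average (fun t => sin (lam n * t%:R)) (fun t => sin (om n * t%:R)) n h
    @[n --> \oo] --> 0.
Proof.
move=> p q na; move: (@cross_average_sin_sin _ _ _ h p q).
apply: cvg_trans; apply: near_eq_cvg; near=> n.
have /resonance_aliased[-> ->] : ~ aliased (lam n) (om n) by near: n.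
by rewrite subr0 !mul0r subr0.
Unshelve. all: by end_near. Qed.

(** For a single frequency the difference resonates and the sum does not: the
    averages keep the cosine of the lag. The frequency may depend on [n], so that
    Fourier frequencies and their limit are treated together. *)
Section OneFrequency.
Variables (lam : nat -> R) (l : R).
Hypothesis l_in : 0 < l < pi.
Hypothesis lam_l : lam n @[n --> \oo] --> l.
Hypothesis lam_cases : fourier_sequence lam \/ fixed_frequency lam.

Let lam_pair : equidistributed (lam \+ lam) /\ equidistributed (lam \- lam).
Proof. by apply: equidistributed_pair; case: lam_cases => ?; [left|right]. Qed.

(* Half of lam n + lam n is lam n, eventually in the open interval from 0 to pi. *)
Let resonance_sum : \forall n \near \oo, resonance (lam n + lam n) = 0.
Proof.
have /andP[l0 lp] := l_in.
near=> n; rewrite /resonance; have -> : (lam n + lam n) / 2 = lam n by field.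
have n0 : 0 < lam n by near: n; exact: (cvgr_gt _ lam_l).
have np : lam n < pi by near: n; exact: (cvgr_lt _ lam_l).
by rewrite gt_eqF// sin_gt0_pi// n0.
Unshelve. all: by end_near. Qed.

Let resonance_diff n : resonance (lam n - lam n) = 1.
Proof. by rewrite /resonance subrr mul0r sin0 eqxx. Qed.

Let cos_lag h : cos (lam n * h%:R) @[n --> \oo] --> cos (l * h%:R).
Proof.
have ll : lam n * h%:R @[n --> \oo] --> l * h%:R by apply: cvgMr_tmp.
exact: (cvg_comp _ _ ll (@continuous_cos R (l * h%:R))).
Qed.

Lemma cross_average_cos_diag h :
  cross_average (fun t => cos (lam n * t%:R)) (fun t => cos (lam n * t%:R)) n h
    @[n --> \oo] --> cos (l * h%:R).
Proof.
have [p q] := lam_pair.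
have H := @cross_average_cos_cos _ _ _ h p q.
rewrite -[X in _ --> X]add0r.
have : cross_average (fun t => cos (lam n * t%:R)) (fun t => cos (lam n * t%:R)) n h
  - (resonance (lam n - lam n) + resonance (lam n + lam n)) / 2 *
    (cos (lam n * h%:R) + cos (lam n * h%:R)) + cos (lam n * h%:R)
    @[n --> \oo] --> 0 + cos (l * h%:R) by apply: cvgD.
apply: cvg_trans; apply: near_eq_cvg; near=> n.
have -> : resonance (lam n + lam n) = 0 by near: n.
by rewrite resonance_diff; field.
Unshelve. all: by end_near. Qed.

Lemma cross_average_sin_diag h :
  cross_average (fun t => sin (lam n * t%:R)) (fun t => sin (lam n * t%:R)) n h
    @[n --> \oo] --> cos (l * h%:R).
Proof.
have [p q] := lam_pair.
have H := @cross_average_sin_sin _ _ _ h p q.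
rewrite -[X in _ --> X]add0r.
have : cross_average (fun t => sin (lam n * t%:R)) (fun t => sin (lam n * t%:R)) n h
  - (resonance (lam n - lam n) - resonance (lam n + lam n)) / 2 *
    (cos (lam n * h%:R) + cos (lam n * h%:R)) + cos (lam n * h%:R)
    @[n --> \oo] --> 0 + cos (l * h%:R) by apply: cvgD.
apply: cvg_trans; apply: near_eq_cvg; near=> n.
have -> : resonance (lam n + lam n) = 0 by near: n.
by rewrite resonance_diff; field.
Unshelve. all: by end_near. Qed.

End OneFrequency.
End Frequencies.

(** * The spectral density as a cosine series *)

Section SpectralDensity.
Context {R : realType}.

(** Pairs opposite lags, whose complex exponentials add up to cosines. *)
Lemma sum_symmetric (V : zmodType) (f : int -> V) N :
  \sum_(k < (N.*2).+1) f ((k : nat)%:Z - N%:Z) =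
  f 0 + \sum_(1 <= h < N.+1) (f h%:Z + f (- h%:Z)).
Proof.
elim: N => [|N IH]; first by rewrite big_ord_recl big_ord0 big_geq// !addr0 subr0.
rewrite doubleS big_ord_recl big_ord_recr/=.
transitivity (f (- N.+1%:Z) +
    (\sum_(k < (N.*2).+1) f ((k : nat)%:Z - N%:Z) + f N.+1%:Z)).
  congr (_ + (_ + _)); first by rewrite sub0r.
    by apply: eq_bigr => k _; congr f; rewrite /bump/=; lia.
  by congr f; rewrite /bump/=; lia.
have -> : \sum_(1 <= h < N.+2) (f h%:Z + f (- h%:Z)) =
    \sum_(1 <= h < N.+1) (f h%:Z + f (- h%:Z)) + (f N.+1%:Z + f (- N.+1%:Z)).
  by rewrite big_nat_recr.
by rewrite IH addrC -!addrA.
Qed.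

Lemma cvg_real_complex (u : nat -> R) (l : R) : u n @[n --> \oo] --> l ->
  (real_complex R (u n) : R[i]^o) @[n --> \oo] --> (real_complex R l : R[i]^o).
Proof.
move=> ul; apply/cvgrPdist_lt => e; rewrite ltcE/= => /andP[/eqP ie re].
move/cvgrPdist_lt : ul => /(_ _ re); apply: filterS => n ln.
rewrite -rmorphB normc_def/= expr0n addr0 sqrtr_sqr ltcE/= ie eqxx/=.
exact: ln.
Qed.

Lemma expiD_opp (x : R) : expi (- x) + expi x = real_complex R (2 * cos x).
Proof.
by apply/eqP; rewrite eq_complex/= cosN sinN; apply/andP; split; apply/eqP; ring.
Qed.

End SpectralDensity.

Lemma cos_sum_spectral (R : realType) (rho : int -> R) (lam : R) (N : nat) :
  (forall h : nat, rho (- h%:Z) = rho h%:Z) -> rho 0 = 1 ->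
  (\sum_(k < (N.*2).+1)
     let h : int := (k : nat)%:Z - N%:Z in
     real_complex R (rho h) * expi (- (h%:~R * lam))) =
  real_complex R (1 + 2 * \sum_(1 <= h < N.+1) cos (lam * h%:R) * rho h%:Z).
Proof.
move=> rhoN rho0 /=.
rewrite (sum_symmetric (fun h => real_complex R (rho h) * expi (- (h%:~R * lam)))).
rewrite rho0 mul0r oppr0 {1}/expi cos0 sin0 rmorphD rmorph1 mul1r; congr (_ + _).
rewrite mulr_sumr rmorph_sum/=; apply: eq_bigr => h _.
rewrite rhoN -mulrDr mulrNz mulNr opprK expiD_opp -rmorphM/=.
by congr (real_complex R _); rewrite -pmulrn [lam * _]mulrC; ring.
Qed.

Lemma lag_series_cos (R : realType) (C rho : nat -> R) (l : R) :
  C 0%N != 0 -> (forall h, rho h = C h / C 0%N) ->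
  let S N := \sum_(1 <= h < N.+1) cos (l * h%:R) * rho h in
  let T N := \sum_(0 <= h < N) lag_weight h * C h * cos (l * h%:R) in
  cvgn T -> cvgn S /\ limn T = C 0%N * (1 + 2 * limn S).
Proof.
move=> C0 rhoE S T cT.
have TS N : S N = (T N.+1 / C 0%N - 1) / 2.
  have E0 : lag_weight 0 * C 0%N * cos (l * 0%:R) = C 0%N.
    by rewrite mulr0 cos0 mulr1 /lag_weight eqxx mul1r.
  rewrite /T big_ltn// E0 [(C 0%N + _) / _]mulrDl divff//.
  rewrite addrAC subrr add0r /S !mulr_suml; apply: eq_big_nat => h /andP[h0 _].
  by rewrite /lag_weight eqn0Ngt h0/= rhoE; field.
have cS : S N @[N --> \oo] --> (limn T / C 0%N - 1) / 2.
  have -> : S = fun N => (T N.+1 / C 0%N - 1) / 2 by apply/funext.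
  apply: cvgMr_tmp; apply: cvgB; last exact: cvg_cst.
  by apply: cvgMr_tmp; rewrite -(cvg_shiftS T) in cT *; exact: cT.
split; first by apply/cvg_ex; eexists; exact: cS.
rewrite (cvg_lim _ cS)//; by field.
Qed.

(** * Asymptotic covariances of the periodogram ordinates *)

Theorem proposition4p1
  (disp : measure_display) (Om : measurableType disp) (R : realType)
  (P : probability Om R) (d : nat) (X : int -> Om -> 'rV[R]_d)
  (al : R) (a : nat -> R)
  (mu : forall h : nat, {measure set (bxmx R h.+1 d) -> \bar R})
  (m r : nat -> nat) (A : set (xmx R 1 d))
  (X_random : random_vectors X)
  (X_stationary : strictly_stationary P X)
  (X_regvar : regularly_varying P X al a mu)
  (X_mixing : condition_M P X a m r)
  (A_borel : borel A)
  (A_bounded : bounded_away_from_zero A)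
  (A_cont0 : continuity_set (mu 0%N) A)
  (A_cont1 : forall h : nat, (1 <= h)%N ->
     continuity_set (mu h) [set M | A (row ord0 M)])
  (A_cont2 : forall h : nat, (1 <= h)%N ->
     continuity_set (mu h) [set M | A (row ord0 M) /\ A (row ord_max M)])
  (A_pos : (0 < mu 0%N A)%E)
  (A_summable :
     (\sum_(1 <= h <oo) (extremogram P X A h%:Z)%:E < +oo)%E) :
  let alp := alpha_n P X A a m in
  let bet := beta_n P X A a m in
  let rho := extremogram P X A in
  (forall lam om : nat -> R,
     (fourier_sequence lam /\ fourier_sequence om) \/
     (fixed_frequency lam /\ fixed_frequency om) ->
     ((\forall n \near \oo, lam n <> om n) ->
        covariance P (alp n (lam n)) (bet n (om n)) @[n --> \oo] --> 0%E) /\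
     ((\forall n \near \oo, ~ aliased (lam n) (om n)) ->
        covariance P (alp n (lam n)) (alp n (om n)) @[n --> \oo] --> 0%E /\
        covariance P (bet n (lam n)) (bet n (om n)) @[n --> \oo] --> 0%E)) /\
  (forall lam : nat -> R, fourier_sequence lam \/ fixed_frequency lam ->
     covariance P (alp n (lam n)) (bet n (lam n)) @[n --> \oo] --> 0%E) /\
  (forall (lam : R) (lamF : nat -> R), 0 < lam < pi ->
     fourier_sequence lamF -> lamF n @[n --> \oo] --> lam ->
     let v := fine (mu 0%N A) *
       (1 + 2 * limn (fun N => \sum_(1 <= h < N.+1)
                                 cos (lam * h%:R) * rho h%:Z)) in
     [/\ 'V_P[alp n (lamF n)] @[n --> \oo] --> v%:E,
         'V_P[alp n lam] @[n --> \oo] --> v%:E,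
         'V_P[bet n (lamF n)] @[n --> \oo] --> v%:E,
         'V_P[bet n lam] @[n --> \oo] --> v%:E &
         real_complex R v =
         real_complex R (fine (mu 0%N A)) * spectral_density P X A lam]).
Proof.
move=> alp bet rho.
have cov_cvg := covariance_cvg X_random X_stationary A_borel X_regvar X_mixing
  A_bounded A_cont0 A_cont2.
have cos1 (lam : nat -> R) n (t : nat) : `|cos (lam n * t%:R)| <= 1 by exact: cos_max.
have sin1 (lam : nat -> R) n (t : nat) : `|sin (lam n * t%:R)| <= 1 by exact: sin_max.
have lim0 : limn (fun N => \sum_(0 <= h < N) lag_weight h * lag_limit mu A h * 0) = 0 :> R.
  under eq_fun do (rewrite big1 => [|h _]; last by rewrite mulr0).
  exact: lim_cst.
have alp_bet (lam om : nat -> R) :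
    (fourier_sequence lam /\ fourier_sequence om) \/
    (fixed_frequency lam /\ fixed_frequency om) ->
    covariance P (alp n (lam n)) (bet n (om n)) @[n --> \oo] --> 0%E.
  move=> /equidistributed_pair[p q].
  have [_] := cov_cvg _ _ _ (cos1 lam) (sin1 om)
    (fun h => @cross_average_cos_sin _ _ _ h p q).
  by rewrite lim0.
split; [|split].
- move=> lam om lam_om; split; first by move=> _; exact: alp_bet.
  move=> na; have [p q] := equidistributed_pair lam_om; split.
    have [_] := cov_cvg _ _ _ (cos1 lam) (cos1 om)
      (fun h => @cross_average_cos_cos0 _ _ _ h p q na).
    by rewrite lim0.
  have [_] := cov_cvg _ _ _ (sin1 lam) (sin1 om)
    (fun h => @cross_average_sin_sin0 _ _ _ h p q na).
  by rewrite lim0.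
- move=> lam lam_cases; apply: alp_bet.
  by case: lam_cases => ?; [left|right].
move=> lam lamF lam_in FlamF lamF_lam v.
have C0 : lag_limit mu A 0 != 0.
  by rewrite gt_eqF// (lag_limit0_gt0 X_regvar).
have C0E : lag_limit mu A 0 = fine (mu 0%N A) by rewrite /lag_limit both_ends0.
have rhoE (h : nat) : rho h%:Z = lag_limit mu A h / lag_limit mu A 0.
  exact: (extremogramE X_random X_regvar A_borel A_bounded A_cont0 A_cont2 A_pos).
have rhoN (h : nat) : rho (- h%:Z) = rho h%:Z by rewrite /rho /extremogram abszN.
have rho0 : rho 0 = 1 by rewrite (rhoE 0%N) divff.
have cst_lam : (fun=> lam) n @[n --> \oo] --> lam by exact: cvg_cst.
have fix_lam : fixed_frequency (fun=> lam) by exists lam.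
have cosF h := cross_average_cos_diag lam_in lamF_lam (or_introl FlamF) h.
have cosC h := cross_average_cos_diag lam_in cst_lam (or_intror fix_lam) h.
have sinF h := cross_average_sin_diag lam_in lamF_lam (or_introl FlamF) h.
have sinC h := cross_average_sin_diag lam_in cst_lam (or_intror fix_lam) h.
have [cl aF] := cov_cvg _ _ _ (cos1 lamF) (cos1 lamF) cosF.
have [_ aC] := cov_cvg _ _ _ (cos1 (fun=> lam)) (cos1 (fun=> lam)) cosC.
have [_ bF] := cov_cvg _ _ _ (sin1 lamF) (sin1 lamF) sinF.
have [_ bC] := cov_cvg _ _ _ (sin1 (fun=> lam)) (sin1 (fun=> lam)) sinC.
have [cS TE] := lag_series_cos C0 rhoE cl.
have vE : limn (fun N => \sum_(0 <= h < N)
    lag_weight h * lag_limit mu A h * cos (lam * h%:R)) = v.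
  by rewrite TE C0E.
rewrite vE in aF aC bF bC.
split; [exact: aF|exact: aC|exact: bF|exact: bC|].
rewrite /v rmorphM/=; congr (_ * _).
apply/esym; rewrite /spectral_density.
apply: (@cvg_lim R[i]^o); first exact: norm_hausdorff.
under eq_fun do rewrite cos_sum_spectral//.
apply: cvg_real_complex.
by apply: cvgD; [exact: cvg_cst|apply: cvgMl_tmp; exact: cS].
Qed.
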